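(* For every integer $r\ge 2$ and every real $2\le p<\infty$ there exist constants $c_{r,p},C_{r,p}>0$, depending only on $r$ and $p$, such that for every integer $d\ge 2$ the type-2 constant $\mathcal{C}_{r,p}(d)$ of the $\ell_p$ injective norm of order $r$ tensors on $\mathbb{R}^d$ satisfies $$ c_{r,p}\, d^{\frac12-\frac1p}\;\le\;\mathcal{C}_{r,p}(d)\;\le\; C_{r,p}\, d^{\frac12-\frac{1}{\max\{p,2r\}}}\,\log d .$$
   Context: For a tensor $T\in(\mathbb{R}^d)^{\otimes r}$ the $\ell_p$ injective norm is $\|T\|_{\mathcal{I}_p}=\sup\{\langle T,x_1\otimes\cdots\otimes x_r\rangle : x_1,\dots,x_r\in\mathbb{R}^d,\ \|x_1\|_p,\dots,\|x_r\|_p\le 1\}$, where $\langle\cdot,\cdot\rangle$ is the entrywise inner product and $(x_1\otimes\cdots\otimes x_r)_{i_1,\dots,i_r}=\prod_{q}(x_q)_{i_q}$. The type-2 constant $\mathcal{C}_{r,p}(d)$ is the minimal number such that for all positive integers $n$ and all (not necessarily symmetric) tensors $T_1,\dots,T_n\in(\mathbb{R}^d)^{\otimes r}$, $$\mathbb{E}\Big\|\sum_{k=1}^n\varepsilon_kT_k\Big\|_{\mathcal{I}_p}^2\le \mathcal{C}_{r,p}(d)^2\sum_{k=1}^n\|T_k\|_{\mathcal{I}_p}^2,$$ where $\varepsilon_1,\dots,\varepsilon_n$ are i.i.d. Rademacher random variables ($\pm1$ with probability $\frac12$ each). *)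

(* Defs.v *)
From HB Require Import structures.
From mathcomp Require Import all_boot all_order all_algebra.
From mathcomp Require Import all_classical all_reals all_analysis.

Set Implicit Arguments.
Unset Strict Implicit.
Unset Printing Implicit Defensive.

Import Order.TTheory GRing.Theory Num.Theory.
Import numFieldNormedType.Exports.

Local Open Scope classical_set_scope.
Local Open Scope ring_scope.

Section InjectiveNorm.
Context {R : realType}.

Definition lp_norm (d : nat) (p : R) (x : 'rV[R]_d) : R :=
  (\sum_(i < d) `|x 0 i| `^ p) `^ p^-1.

(* Entries are indexed by multi-indices (i_1, ..., i_r); [R^o] makes
   [tensor r d] an R-module for the pointwise operations. *)
Definition tensor (r d : nat) : Type := {ffun {ffun 'I_r -> 'I_d} -> R^o}.

Definition tensor_inner (r d : nat) (S T : tensor r d) : R :=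
  \sum_(i : {ffun 'I_r -> 'I_d}) S i * T i.

Definition elementary_tensor (r d : nat) (x : 'I_r -> 'rV[R]_d) : tensor r d :=
  [ffun i : {ffun 'I_r -> 'I_d} => \prod_(q < r) x q 0 (i q)].

Definition injective_norm (r d : nat) (p : R) (T : tensor r d) : R :=
  sup [set tensor_inner T (elementary_tensor x) |
       x in [set x : 'I_r -> 'rV[R]_d | forall q, lp_norm p (x q) <= 1]].

End InjectiveNorm.
Arguments tensor R r d : clear implicits.

Section Rademacher.
Context {R : realType} {dO : measure_display} {Omega : measurableType dO}.
Variable P : probability Omega R.

Definition rademacher (e : {RV P >-> R}) : Prop :=
  P [set w | e w = 1] = (2^-1)%:E /\ P [set w | e w = -1] = (2^-1)%:E.

Definition independent_RVs (n : nat) (e : 'I_n -> {RV P >-> R}) : Prop :=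
  forall (J : {set 'I_n}) (A : 'I_n -> set R),
    (forall k, k \in J -> measurable (A k)) ->
    P (\bigcap_(k in [set` J]) (e k @^-1` A k)) =
    (\prod_(k in J) P (e k @^-1` A k))%E.

Definition iid_rademacher (n : nat) (e : 'I_n -> {RV P >-> R}) : Prop :=
  independent_RVs e /\ forall k, rademacher (e k).

End Rademacher.

Definition type2_bound (R : realType) (r : nat) (p : R) (d : nat) (C : R) : Prop :=
  forall (n : nat) (T : 'I_n -> tensor R r d), (0 < n)%N ->
  forall (dO : measure_display) (Omega : measurableType dO)
    (P : probability Omega R) (e : 'I_n -> {RV P >-> R}),
    iid_rademacher e ->
    ('E_P[fun w => (injective_norm p (\sum_(k < n) e k w *: T k) ^+ 2)%R] <=
     (C ^+ 2 * \sum_(k < n) injective_norm p (T k) ^+ 2)%R%:E)%E.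

(* The infimum is taken in [\bar R], so it is [+oo] if no bound exists;
   [0 <= C] is needed because [C] only enters through its square. *)
Definition type2_constant (R : realType) (r : nat) (p : R) (d : nat) : \bar R :=
  ereal_inf [set C%:E | C in [set C : R | 0 <= C /\ type2_bound r p d C]].

(* Main.v *)
(* Upper bound.  Let [m = max p 2r] and [tau = d ^ (1/m - 1/p)].  A multilinear form takes
   at [x] the value of its mean at independent perturbations of the coordinates of [x]
   with mean zero.  Take each coordinate to be a rescaled sum of [d] signs of standard
   deviation at most [tau]; its law has, relative to fair signs, relative entropy of
   order [x_i^2 / tau^2].  A change of measure (PAC-Bayes) then bounds
   [lam * <sum_k eps_k T_k, x>], simultaneously for all [x], by [lam^2] times the smoothed
   variance [sum_k E T_k(y)^2], plus the entropy, which is of order [d^(1 - 2/m)] on the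
   l_p ball, plus a random variable independent of [x] with bounded second moment.
   The second moment [E T(y)^2] is the squared Frobenius norm of the tensor obtained by
   evaluating [T] in every slot at [x] and at the vectors [tau e_i]; by the
   Hardy-Littlewood inequality [|T|_F <= C_r |T|_{I_2r}] it is at most
   [C_r |T|_{I_p}^2].  Optimizing over [lam] gives [d^(1/2 - 1/m)] without the logarithm.

   Lower bound.  Take [T_k = e_k (x) e_1 (x) ... (x) e_1] for [k <= d]: each has norm at
   most 1, while [sum_k eps_k T_k] has norm at least [d^(1 - 1/p)] for all signs. *)

Require Import Defs.
From HB Require Import structures.
From mathcomp Require Import all_boot all_order all_algebra.
From mathcomp Require Import all_classical all_reals all_analysis.
From mathcomp Require Import measurable_realfun ring lra.

Import Order.TTheory GRing.Theory Num.Theory.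
Import numFieldNormedType.Exports.

Local Open Scope ring_scope.

(** * Averages over finite types *)

Section FiniteAverage.
Context {R : realType}.
Implicit Types W A B Q : finType.

Definition avg {W : finType} (f : W -> R) : R := (\sum_w f w) / #|W|%:R.

Lemma avgD W (f g : W -> R) : avg (fun w => f w + g w) = avg f + avg g.
Proof. by rewrite /avg big_split /= mulrDl. Qed.

Lemma avgZ W c (f : W -> R) : avg (fun w => c * f w) = c * avg f.
Proof. by rewrite /avg -mulr_sumr mulrA. Qed.

Lemma avg_sum W (I : finType) (f : I -> W -> R) :
  avg (fun w => \sum_i f i w) = \sum_i avg (f i).
Proof. by rewrite /avg exchange_big /= mulr_suml. Qed.

Lemma avgC W B (f : W -> B -> R) :
  avg (fun w => avg (f w)) = avg (fun b => avg (f^~ b)).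
Proof.
rewrite /avg -!mulr_suml exchange_big /=.
by rewrite -!mulrA [_^-1 * _]mulrC.
Qed.

Lemma le_avg W (f g : W -> R) : (forall w, f w <= g w) -> avg f <= avg g.
Proof.
by move=> fg; rewrite ler_wpM2r ?invr_ge0// ler_sum.
Qed.

Lemma avg_ge0 W (f : W -> R) : (forall w, 0 <= f w) -> 0 <= avg f.
Proof. by move=> f0; rewrite mulr_ge0 ?invr_ge0// sumr_ge0. Qed.

Lemma eq_avg W (f g : W -> R) : f =1 g -> avg f = avg g.
Proof. by move=> fg; rewrite /avg (eq_bigr _ (fun w _ => fg w)). Qed.

Lemma avg_cst W c : (0 < #|W|)%N -> avg (fun _ : W => c) = c.
Proof.
by move=> W0; rewrite /avg sumr_const -[c *+ _]mulr_natr mulfK// pnatr_eq0 -lt0n.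
Qed.

Lemma avg_bool (f : bool -> R) : avg f = (f true + f false) / 2.
Proof. by rewrite /avg big_bool card_bool. Qed.

Lemma avg_prod Q B (h : Q -> B -> R) :
  avg (fun e : {ffun Q -> B} => \prod_q h q (e q)) = \prod_q avg (h q).
Proof.
rewrite /avg -bigA_distr_bigA big_split /= card_ffun natrX -exprVn.
by rewrite prodr_const.
Qed.

Lemma card_ffun_gt0 Q B : (0 < #|B|)%N -> (0 < #|{ffun Q -> B}|)%N.
Proof. by move=> B0; rewrite card_ffun expn_gt0 B0. Qed.

Lemma sqr_avg_le W (f : W -> R) : (0 < #|W|)%N ->
  avg f ^+ 2 <= avg (fun w => f w ^+ 2).
Proof.
move=> W0; set m := avg f.
have: 0 <= avg (fun w => (f w - m) ^+ 2) by apply: avg_ge0 => w; exact: sqr_ge0.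
rewrite (eq_avg _ _ (fun w => f w ^+ 2 + ((- 2 * m) * f w + m ^+ 2))); last first.
  by move=> w; ring.
by rewrite !avgD avgZ avg_cst// -/m; lra.
Qed.

(* The hypothesis on [v] covers the convention [x / 0 = 0]. *)
Lemma sqr_sum_le_weighted (I : finType) (P : pred I) (a v : I -> R) :
  (forall i, P i -> 0 <= v i) -> (forall i, P i -> v i = 0 -> a i = 0) ->
  (\sum_(i | P i) a i) ^+ 2 <=
  (\sum_(i | P i) v i) * \sum_(i | P i) a i ^+ 2 / v i.
Proof.
move=> v0 va; set V := \sum_(i | P i) v i; set S := \sum_(i | P i) a i.
have [V0|Vn0] := eqVneq V 0.
  rewrite V0 mul0r /S big1 ?expr0n// => i Pi; apply: va => //.
  by apply: (psumr_eq0P v0 V0).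
have V_gt0 : 0 < V by rewrite lt0r Vn0 sumr_ge0.
(* The summand is the square [(a i - v i * S / V) ^ 2 / v i], expanded; the whole sum equals
   [\sum a i ^ 2 / v i - S ^ 2 / V]. *)
suff : 0 <= \sum_(i | P i) (a i ^+ 2 / v i - 2 * S / V * a i + S ^+ 2 / V ^+ 2 * v i).
  rewrite !big_split /= sumrN -!mulr_sumr -/S -/V => H.
  rewrite -ler_pdivrMl//; apply: le_trans (_ : 2 * S / V * S - S ^+ 2 / V ^+ 2 * V <= _); last lra.
  by rewrite le_eqVlt; apply/orP; left; apply/eqP; field.
apply: sumr_ge0 => i Pi; have [vi0|vin0] := eqVneq (v i) 0.
  by rewrite (va i Pi vi0) vi0 expr0n /= !(mul0r, mulr0) subr0 addr0.
rewrite (_ : _ + _ = (a i - v i * S / V) ^+ 2 / v i); last by field; rewrite vin0.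
by rewrite divr_ge0 ?sqr_ge0 ?v0.
Qed.

End FiniteAverage.

(** * Moments of Rademacher chaoses *)

Section RademacherChaos.
Context {R : realType}.

Definition sg (b : bool) : R := (-1) ^+ b.

Lemma sgN b : sg (~~ b) = - sg b.
Proof. by case: b; rewrite /sg ?expr1 ?expr0 ?opprK. Qed.

Lemma sqr_sg b : sg b ^+ 2 = 1.
Proof. by rewrite /sg sqrr_sign. Qed.

Definition flip {I : finType} (i : I) (e : {ffun I -> bool}) : {ffun I -> bool} :=
  [ffun x => if x == i then ~~ e x else e x].

Lemma flipK (I : finType) (i : I) : involutive (flip i).
Proof. by move=> e; apply/ffunP => x; rewrite !ffunE; case: eqP => //; rewrite negbK. Qed.

(** Pairing each sign pattern with its flip at [i] cancels the odd powers of the [i]-th sign. *)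
Lemma avg_flip (I : finType) (i : I) (f : {ffun I -> bool} -> R) :
  avg f = avg (fun e => (f e + f (flip i e)) / 2).
Proof.
have E : avg f = avg (fun e => f (flip i e)).
  by rewrite /avg (reindex_inj (inv_inj (@flipK I i))).
rewrite [RHS](eq_avg _ _ (fun e => 2^-1 * (f e + f (flip i e)))); last by move=> e; rewrite mulrC.
by rewrite avgZ avgD -E; lra.
Qed.

(** The first clause says that [phi] is orthonormal in L2 of the uniform law on [W]; the second is a
    Khintchine (L4 against L2) inequality on its span. *)
Definition hypercontractive {W I : finType} (K : R) (phi : I -> W -> R) : Prop :=
  forall c : I -> R,
    avg (fun w => (\sum_i c i * phi i w) ^+ 2) = \sum_i c i ^+ 2 /\
    avg (fun w => (\sum_i c i * phi i w) ^+ 4) <= K * (\sum_i c i ^+ 2) ^+ 2.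

(** Induction on the signs: averaging over one sign turns [(X + c * sg) ^ 4] into
    [X ^ 4 + 6 c ^ 2 X ^ 2 + c ^ 4], which fits into [3 (v + c ^ 2) ^ 2 = 3 v ^ 2 + 6 c ^ 2 v + 3 c
    ^ 4]. *)
Lemma hypercontractive_signs (I : finType) :
  hypercontractive 3 (fun (i : I) (e : {ffun I -> bool}) => sg (e i)).
Proof.
move=> c.
have E (s : seq I) : uniq s ->
  avg (fun e : {ffun I -> bool} => (\sum_(i <- s) c i * sg (e i)) ^+ 2)
    = \sum_(i <- s) c i ^+ 2 /\
  avg (fun e : {ffun I -> bool} => (\sum_(i <- s) c i * sg (e i)) ^+ 4)
    <= 3 * (\sum_(i <- s) c i ^+ 2) ^+ 2.
  elim: s => [_|i s IH /= /andP[nis us]].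
    rewrite !big_nil; split.
      rewrite (eq_avg _ _ (fun=> 0)) ?avg_cst// ?card_ffun_gt0 ?card_bool//.
      by move=> e; rewrite big_nil expr0n.
    rewrite (eq_avg _ _ (fun=> 0)) ?avg_cst ?card_ffun_gt0 ?card_bool ?expr0n ?mulr0//.
    by move=> e; rewrite big_nil expr0n.
  have [IH2 IH4] := IH us.
  set X := fun e : {ffun I -> bool} => \sum_(i <- s) c i * sg (e i).
  have Xf e : X (flip i e) = X e.
    rewrite /X big_seq [RHS]big_seq; apply: eq_bigr => j js; rewrite ffunE.
    by case: eqP => // ji; rewrite -ji js in nis.
  have fi e : sg (flip i e i) = - sg (e i) by rewrite ffunE eqxx sgN.
  rewrite !big_cons; split.
    rewrite (avg_flip _ i) (eq_avg _ _ (fun e => X e ^+ 2 + c i ^+ 2)); last first.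
      move=> e; rewrite !big_cons fi -/(X _) -/(X _) Xf.
      rewrite [RHS](_ : _ = X e ^+ 2 + c i ^+ 2 * sg (e i) ^+ 2); last by rewrite sqr_sg mulr1.
      by field.
    by rewrite avgD IH2 avg_cst ?card_ffun_gt0 ?card_bool// addrC.
  rewrite (avg_flip _ i) (eq_avg _ _ (fun e => X e ^+ 4 + (6 * c i ^+ 2 * X e ^+ 2 + c i ^+ 4))); last first.
    move=> e; rewrite !big_cons fi -/(X _) -/(X _) Xf.
    rewrite [RHS](_ : _ = X e ^+ 4 + (6 * (c i ^+ 2 * sg (e i) ^+ 2) * X e ^+ 2 + c i ^+ 4 * (sg (e i) ^+ 2) ^+ 2)).
      by field.
    by rewrite sqr_sg expr1n !mulr1.
  rewrite !avgD avgZ IH2 avg_cst ?card_ffun_gt0 ?card_bool//.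
  set v := \sum_(i <- s) _ in IH4 *.
  have : 0 <= c i ^+ 4 by rewrite (exprM _ 2 2) sqr_ge0.
  rewrite (_ : 3 * _ = 3 * v ^+ 2 + 6 * c i ^+ 2 * v + 3 * c i ^+ 4); last by ring.
  by rewrite -/X in IH4 *; lra.
by apply: E; exact: index_enum_uniq.
Qed.

(** With [w] frozen, the second family bounds the fourth moment by [K2 (\sum_j A j w ^ 2) ^ 2].
    Cauchy-Schwarz with weights [v j], the mean of [A j w ^ 2], separates the indices [j], and the
    first family bounds each mean of [A j w ^ 4] by [K1 * v j ^ 2]. *)
Lemma hypercontractive_tensor (W1 W2 I J : finType) K1 K2
    (phi : I -> W1 -> R) (psi : J -> W2 -> R) (c : I -> J -> R) :
    0 <= K2 ->
  hypercontractive K1 phi -> hypercontractive K2 psi ->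
  avg (fun w => avg (fun v => (\sum_i \sum_j c i j * (phi i w * psi j v)) ^+ 2))
    = \sum_i \sum_j c i j ^+ 2 /\
  avg (fun w => avg (fun v => (\sum_i \sum_j c i j * (phi i w * psi j v)) ^+ 4))
    <= K1 * K2 * (\sum_i \sum_j c i j ^+ 2) ^+ 2.
Proof.
move=> K20 H1 H2.
pose A j w := \sum_i c i j * phi i w.
pose v j := \sum_i c i j ^+ 2.
have AE w u : \sum_i \sum_j c i j * (phi i w * psi j u) = \sum_j A j w * psi j u.
  rewrite exchange_big; apply: eq_bigr => j _; rewrite mulr_suml.
  by apply: eq_bigr => i _; rewrite mulrA.
have vE : \sum_i \sum_j c i j ^+ 2 = \sum_j v j by rewrite exchange_big.
rewrite vE; split.
  rewrite (eq_avg _ _ (fun w => \sum_j A j w ^+ 2)); last first.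
    move=> w; rewrite -(H2 (A^~ w)).1; apply: eq_avg => u; by rewrite AE.
  by rewrite avg_sum; apply: eq_bigr => j _; rewrite (H1 (c^~ j)).1.
apply: (@le_trans _ _ (avg (fun w => K2 * ((\sum_j v j) * \sum_j (A j w ^+ 2) ^+ 2 / v j)))).
  apply: le_avg => w.
  rewrite (eq_avg _ _ (fun u => (\sum_j A j w * psi j u) ^+ 4)); last by move=> u; rewrite AE.
  apply: le_trans (H2 (A^~ w)).2 _; rewrite ler_wpM2l//.
  apply: sqr_sum_le_weighted => j _; first by apply: sumr_ge0 => i _; exact: sqr_ge0.
  move=> v0; rewrite /A big1 ?expr0n// => i _.
  have /eqP := (psumr_eq0P (fun i _ => sqr_ge0 (c i j)) v0) i isT.
  by rewrite sqrf_eq0 => /eqP ->; rewrite mul0r.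
rewrite avgZ avgZ avg_sum.
rewrite [leRHS](_ : _ = K2 * ((\sum_j v j) * (\sum_j K1 * v j))); last first.
  by rewrite -mulr_sumr; ring.
rewrite ler_wpM2l// ler_wpM2l//.
  by apply: sumr_ge0 => j _; apply: sumr_ge0 => i _; exact: sqr_ge0.
apply: ler_sum => j _.
have v0 : 0 <= v j by apply: sumr_ge0 => i _; exact: sqr_ge0.
rewrite (eq_avg _ _ (fun w => (v j)^-1 * A j w ^+ 4)); last first.
  by move=> w; rewrite mulrC -exprM.
rewrite avgZ; have [vj0|vn0] := eqVneq (v j) 0.
  by rewrite vj0 invr0 mul0r mulr0.
rewrite ler_pdivrMl ?lt0r ?vn0//.
by apply: le_trans (H1 (c^~ j)).2 _; rewrite expr2 mulrCA.
Qed.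

Definition fcons {I : finType} {r : nat} (u : I * {ffun 'I_r -> I}) : {ffun 'I_r.+1 -> I} :=
  [ffun q => oapp u.2 u.1 (unlift ord0 q)].

Lemma fcons_bij (I : finType) r : bijective (@fcons I r).
Proof.
exists (fun g : {ffun 'I_r.+1 -> I} => (g ord0, [ffun q => g (lift ord0 q)])).
  move=> [i f]; rewrite /fcons /= !ffunE unlift_none /=; congr pair.
  by apply/ffunP => q; rewrite !ffunE liftK.
by move=> g; apply/ffunP => q; rewrite ffunE; case: unliftP => [q' ->|->] //=; rewrite ffunE.
Qed.

Lemma sum_fcons (I : finType) r (F : {ffun 'I_r.+1 -> I} -> R) :
  \sum_g F g = \sum_i \sum_f F (fcons (i, f)).
Proof.
rewrite pair_big /= (reindex (@fcons I r)) /=; last exact/onW_bij/fcons_bij.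
by apply: eq_bigr => -[i f] _.
Qed.

Lemma prod_fcons (I J : finType) r i (f : {ffun 'I_r -> I}) w (e : {ffun 'I_r -> J})
    (F : I -> J -> R) :
  \prod_q F (fcons (i, f) q) (fcons (w, e) q) = F i w * \prod_q F (f q) (e q).
Proof.
rewrite big_ord_recl !ffunE unlift_none /=; congr (_ * _).
by apply: eq_bigr => q _; rewrite !ffunE liftK.
Qed.

Lemma avg_fcons (W : finType) r (F : {ffun 'I_r.+1 -> W} -> R) :
  avg F = avg (fun w => avg (fun e => F (fcons (w, e)))).
Proof.
rewrite /avg sum_fcons -mulr_suml -mulrA; congr (_ * _).
rewrite -invfM -natrM; congr (_%:R^-1).
by rewrite !card_ffun !card_ord expnS mulnC.
Qed.

(** Induction on the order, splitting off the first slot with [hypercontractive_tensor]. The chaos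
    is decoupled: each slot has its own independent sample [w q]. *)
Lemma hypercontractive_chaos (W I : finType) K (phi : I -> W -> R) (r : nat) :
  0 <= K -> hypercontractive K phi ->
  hypercontractive (K ^+ r)
    (fun (j : {ffun 'I_r -> I}) (w : {ffun 'I_r -> W}) => \prod_q phi (j q) (w q)).
Proof.
move=> K0 H; elim: r => [|r IH] c.
  pose z : {ffun 'I_0 -> I} := ffun0 (card_ord 0).
  have Ez (T : finType) (f : {ffun 'I_0 -> T}) : f = ffun0 (card_ord 0).
    by apply/ffunP => -[].
  have S0 (F : {ffun 'I_0 -> I} -> R) : \sum_j F j = F z.
    rewrite (bigD1 z) //= big1 ?addr0// => j /negP; rewrite (Ez _ j); by case.
  have C : (0 < #|{ffun 'I_0 -> W}|)%N by rewrite card_ffun card_ord.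
  have E w : \sum_j c j * \prod_(q < 0) phi (j q) (w q) = c z by rewrite S0 big_ord0 mulr1.
  split.
    rewrite (eq_avg _ _ (fun=> c z ^+ 2)) ?avg_cst ?S0// => w.
    by rewrite E.
  rewrite (eq_avg _ _ (fun=> c z ^+ 4)) ?avg_cst ?S0 ?expr0 ?mul1r -?exprM// => w.
  by rewrite E.
have [T2 T4] := hypercontractive_tensor _ _ _ _ _ _ _ _
  (fun i f => c (fcons (i, f))) (exprn_ge0 r K0) H IH.
have E w e : \sum_j c j * \prod_q phi (j q) (fcons (w, e) q) =
    \sum_i \sum_f c (fcons (i, f)) * (phi i w * \prod_q phi (f q) (e q)).
  rewrite sum_fcons; apply: eq_bigr => i _; apply: eq_bigr => f _.
  by rewrite prod_fcons.
rewrite !sum_fcons !avg_fcons exprS; split.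
  by rewrite -T2; apply: eq_avg => w; apply: eq_avg => e; rewrite E.
apply: le_trans T4; rewrite le_eqVlt; apply/orP; left; apply/eqP.
by apply: eq_avg => w; apply: eq_avg => e; rewrite E.
Qed.

(* The pointwise inequality [u >= u ^ 2 - u ^ 4 / 4] at [u = `|Y| / sqrt (K v)]
   turns the moment bounds into a lower bound on the first moment. *)
Lemma hypercontractive_L1 (W I : finType) K (phi : I -> W -> R) (c : I -> R) :
  0 < K -> hypercontractive K phi ->
  3 / 4 / Num.sqrt K * Num.sqrt (\sum_i c i ^+ 2) <=
  avg (fun w => `|\sum_i c i * phi i w|).
Proof.
move=> K0 H; have [H2 H4] := H c.
set v := \sum_i _ in H2 H4 *.
have v0 : 0 <= v by apply: sumr_ge0 => i _; exact: sqr_ge0.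
have [->|vn0] := eqVneq v 0.
  by rewrite sqrtr0 mulr0; apply: avg_ge0.
have vgt : 0 < v by rewrite lt0r vn0.
set k := Num.sqrt K; set u := Num.sqrt v.
have k0 : 0 < k by rewrite sqrtr_gt0.
have u0 : 0 < u by rewrite sqrtr_gt0.
have kE : K = k ^+ 2 by rewrite sqr_sqrtr ?ltW.
have uE : v = u ^+ 2 by rewrite sqr_sqrtr.
have s0 : 0 < k * u by rewrite mulr_gt0.
have pw (y : R) : (k * u)^-1 * y ^+ 2 + (- (4 * (k * u) ^+ 3)^-1) * y ^+ 4 <= `|y|.
  rewrite (exprM y 2 2) -[y ^+ 2]real_normK ?num_real// -exprM.
  set a := `|y|; have a0 : 0 <= a by rewrite normr_ge0.
  set s := k * u; set b := a / s.
  have b0 : 0 <= b by rewrite divr_ge0// ltW.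
  have -> : a = b * s by rewrite /b divfK ?gt_eqF.
  rewrite -subr_ge0 [X in 0 <= X](_ : _ = s * (b * (1 - b + b ^+ 3 / 4))); last first.
    by field; rewrite gt_eqF.
  apply: mulr_ge0; first exact: ltW.
  apply: mulr_ge0 => //.
  (* This is the tangent line bound [b ^ 3 >= 75 / 16 * b - 125 / 32] at [b = 5 / 4]; it leaves [1 -
     b + b ^ 3 / 4 >= 3 / 128 + 11 / 64 * b]. *)
  have : 0 <= (b - 5 / 4) ^+ 2 * (b + 5 / 2) by rewrite mulr_ge0 ?sqr_ge0 ?addr_ge0.
  nra.
apply: le_trans (le_avg _ _ _ (fun w => pw _)).
rewrite avgD !avgZ H2.
have : 0 < (4 * (k * u) ^+ 3)^-1 by rewrite invr_gt0 mulr_gt0// exprn_gt0.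
set t := (_^-1 in X in X -> _) => t0.
have : t * avg (fun w => (\sum_i c i * phi i w) ^+ 4) <= t * (K * v ^+ 2) by rewrite ler_pM2l.
rewrite mulNr => h; apply: (@le_trans _ _ ((k * u)^-1 * v - t * (K * v ^+ 2))); last by rewrite lerD2l lerN2.
(* The two terms are [u / k] and [u / (4 k)], whence the factor [3 / 4]. *)
rewrite kE uE /t le_eqVlt; apply/orP; left; apply/eqP; field.
by rewrite !gt_eqF.
Qed.

End RademacherChaos.

(** * A Hardy-Littlewood inequality *)

Section HardyLittlewood.
Context {R : realType}.

Lemma powR_inv_nat (x : R) n : (0 < n)%N -> 0 <= x -> (x `^ n%:R^-1) ^+ n = x.
Proof.
move=> n0 x0; rewrite -powR_mulrn ?powR_ge0// -powRrM mulVf ?powRr1//.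
by rewrite pnatr_eq0 -lt0n.
Qed.

(* Averaging the tensor over random signs in all slots but [q0], and choosing in
   slot [q0] the signs that make every term nonnegative. *)
Lemma random_sign_lower_bound (r : nat) (I : finType) (T : {ffun 'I_r -> I} -> R) (M : R)
    (a : 'I_r -> I -> R) (q0 : 'I_r) :
  (forall z : 'I_r -> I -> R, (forall q i, `|z q i| = a q i) ->
     \sum_j T j * \prod_q z q (j q) <= M) ->
  (forall q i, 0 <= a q i) ->
  3 / 4 / Num.sqrt (3 ^+ r) * \sum_i a q0 i *
    Num.sqrt (\sum_(j : {ffun 'I_r -> I} | j q0 == i) (T j * \prod_(q | q != q0) a q (j q)) ^+ 2) <= M.
Proof.
move=> hM a0.
pose c i (j : {ffun 'I_r -> I}) :=
  if j q0 == i then T j * \prod_(q | q != q0) a q (j q) else 0.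
(* Slot [q0] carries a random sign as well, so that [Y i] is a full chaos of order [r]; since [c i]
   fixes [j q0 = i], that sign is a common factor of [Y i e] and leaves its absolute value
   unchanged. *)
pose Y i (e : {ffun 'I_r -> {ffun I -> bool}}) : R :=
  \sum_j c i j * \prod_q sg (e q (j q)).
have YM e : \sum_i a q0 i * `|Y i e| <= M.
  pose z q i : R := a q i * sg (e q i) * (if q == q0 then (-1) ^+ (Y i e < 0)%R else 1).
  suff -> : \sum_i a q0 i * `|Y i e| = \sum_j T j * \prod_q z q (j q).
    apply: hM => q i; rewrite /z !normrM /sg normr_sign mulr1 ger0_norm//.
    by case: ifP; rewrite ?normr_sign ?normr1 mulr1.
  pose s i : R := (-1) ^+ (Y i e < 0)%R.
  transitivity (\sum_i \sum_j a q0 i * s i * (c i j * \prod_q sg (e q (j q)))).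
    by apply: eq_bigr => i _; rewrite normrEsign mulrA mulr_sumr.
  rewrite exchange_big /=; apply: eq_bigr => j _.
  rewrite (bigD1 (j q0)) //= [X in _ + X]big1 ?addr0; last first.
    by move=> i; rewrite eq_sym => /negPf ji; rewrite /c ji mul0r mulr0.
  have zE : \prod_q z q (j q) = \prod_q a q (j q) * \prod_q sg (e q (j q)) * s (j q0).
    rewrite /z !big_split /=; congr (_ * _).
    by rewrite (bigD1 q0)//= eqxx big1 ?mulr1// => q /negPf ->.
  by rewrite /c eqxx zE [\prod_q a q (j q)](bigD1 q0) //=; ring.
have H3 : hypercontractive (3 ^+ r) (fun (j : {ffun 'I_r -> I})
    (e : {ffun 'I_r -> {ffun I -> bool}}) => \prod_q (sg (e q (j q)) : R)).
  exact: (hypercontractive_chaos _ _ _ _ r _ (hypercontractive_signs I)).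
have C : (0 < #|{ffun 'I_r -> {ffun I -> bool}}|)%N.
  by rewrite !card_ffun_gt0 ?card_bool.
rewrite -[leRHS](avg_cst _ M C); apply: le_trans (le_avg _ _ _ YM).
rewrite avg_sum mulr_sumr; apply: ler_sum => i _.
rewrite avgZ mulrCA ler_wpM2l//.
apply: le_trans (hypercontractive_L1 _ _ _ _ (c i) _ H3); last by rewrite exprn_gt0.
rewrite le_eqVlt; apply/orP; left; apply/eqP; congr (_ * Num.sqrt _).
rewrite big_mkcond /=; apply: eq_bigr => j _; rewrite /c.
by case: ifP => //; rewrite expr0n.
Qed.

(* The weights [a q = (mu q) ^ (1 / 2r)], where [mu q] is the [q]-th marginal of the
   probability [T ^ 2 / |T| ^ 2], work because for every multi-index [j] one of the
   ratios [\prod_q a q (j q) / (a q0 (j q0)) ^ r] (take the smallest factor) is at least 1. *)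
Theorem hardy_littlewood (r : nat) (I : finType) (T : {ffun 'I_r -> I} -> R) (M : R) :
  (0 < r)%N -> 0 <= M ->
  (forall z : 'I_r -> I -> R, (forall q, \sum_i `|z q i| ^+ (2 * r) <= 1) ->
     \sum_j T j * \prod_q z q (j q) <= M) ->
  \sum_j T j ^+ 2 <= (r%:R * 4 / 3) ^+ 2 * 3 ^+ r * M ^+ 2.
Proof.
move=> r0 M0 hM; set S := \sum_j T j ^+ 2.
have S0 : 0 <= S by apply: sumr_ge0 => j _; exact: sqr_ge0.
have [->|Sn0] := eqVneq S 0.
  by rewrite !mulr_ge0 ?sqr_ge0 ?exprn_ge0.
have Sgt : 0 < S by rewrite lt0r Sn0.
pose p (j : {ffun 'I_r -> I}) := T j ^+ 2 / S.
have p0 j : 0 <= p j by rewrite divr_ge0 ?sqr_ge0.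
have p1 : \sum_j p j = 1 by rewrite -mulr_suml divff.
pose mu q i := \sum_(j : {ffun 'I_r -> I} | j q == i) p j.
have mu0 q i : 0 <= mu q i by apply: sumr_ge0.
have mu1 q : \sum_i mu q i = 1.
  by rewrite -p1 (partition_big (fun j : {ffun 'I_r -> I} => j q) predT).
pose a q i := mu q i `^ (2 * r)%:R^-1.
have a0 q i : 0 <= a q i by exact: powR_ge0.
have aE q i : a q i ^+ (2 * r) = mu q i by rewrite powR_inv_nat ?muln_gt0.
have p_gt0 j q : 0 < p j -> 0 < a q (j q).
  move=> pj; rewrite lt0r a0 andbT; apply: contraTneq pj => aj.
  have : mu q (j q) = 0 by rewrite -aE aj expr0n muln_eq0 /= eqn0Ngt r0.
  by move=> /psumr_eq0P -> //; rewrite ltxx.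
set k : R := 3 / 4 / Num.sqrt (3 ^+ r).
have k0 : 0 < k by rewrite !divr_gt0 ?sqrtr_gt0 ?exprn_gt0.
(* In the slice [j q0 = i], of mass [mu q0 i], Cauchy-Schwarz bounds the [p]-mean of the remaining
   weights by the square root in the random-sign bound; the exponent [1 / 2r] makes [a q0 i ^ r]
   equal to [sqrt (mu q0 i)], which is the loss incurred. *)
have Q (q0 : 'I_r) :
    k * (Num.sqrt S * \sum_j p j * (\prod_q a q (j q) / a q0 (j q0) ^+ r)) <= M.
  have := @random_sign_lower_bound r I T M a q0.
  move=> h; apply: le_trans (h _ a0) => //; last first.
    move=> z za; apply: hM => q; rewrite -(mu1 q) le_eqVlt; apply/orP; left; apply/eqP.
    by apply: eq_bigr => i _; rewrite za aE.
  rewrite ler_pM2l// (partition_big (fun j : {ffun 'I_r -> I} => j q0) predT)//= mulr_sumr.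
  apply: ler_sum => i _.
  set B := fun j : {ffun 'I_r -> I} => \prod_(q | q != q0) a q (j q).
  have B0 j : 0 <= B j by apply: prodr_ge0.
  have [ai0|ain0] := eqVneq (a q0 i) 0.
    rewrite ai0 mul0r big1 ?mulr0// => j /eqP ji.
    have [->|pn] := eqVneq (p j) 0; first by rewrite mul0r.
    by have := @p_gt0 j q0; rewrite ji ai0 ltxx lt0r pn p0 => /(_ isT).
  have ai : 0 < a q0 i by rewrite lt0r ain0 a0.
  have -> : \sum_(j : {ffun 'I_r -> I} | j q0 == i) p j * (\prod_q a q (j q) / a q0 (j q0) ^+ r) =
      a q0 i / a q0 i ^+ r * \sum_(j : {ffun 'I_r -> I} | j q0 == i) p j * B j.
    rewrite mulr_sumr; apply: eq_bigr => j /eqP ji.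
    by rewrite (bigD1 q0) //= ji -/(B j); ring.
  have CS : (\sum_(j : {ffun 'I_r -> I} | j q0 == i) p j * B j) ^+ 2 <=
      mu q0 i * \sum_(j : {ffun 'I_r -> I} | j q0 == i) p j * B j ^+ 2.
    have := sqr_sum_le_weighted _ (fun j : {ffun 'I_r -> I} => j q0 == i)
      (fun j => p j * B j) p (fun j _ => p0 j).
    have hz (j : {ffun 'I_r -> I}) : j q0 == i -> p j = 0 -> p j * B j = 0 by move=> _ ->; rewrite mul0r.
    move=> /(_ hz) /le_trans; apply.
    rewrite -/(mu q0 i) ler_wpM2l//; apply: ler_sum => j _.
    have [->|pn] := eqVneq (p j) 0; first by rewrite mul0r expr0n /= !mul0r.
    rewrite le_eqVlt; apply/orP; left; apply/eqP; by field.
  have SE : \sum_(j : {ffun 'I_r -> I} | j q0 == i) (T j * B j) ^+ 2 = S * \sum_(j : {ffun 'I_r -> I} | j q0 == i) p j * B j ^+ 2.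
    by rewrite mulr_sumr; apply: eq_bigr => j _; rewrite /p; field.
  rewrite SE sqrtrM// mulrA [Num.sqrt S * _]mulrC -!mulrA ler_pM2l//.
  rewrite mulrCA ler_wpM2l ?sqrtr_ge0//.
  rewrite ler_pdivrMl ?exprn_gt0//.
  have -> : a q0 i ^+ r = Num.sqrt (mu q0 i).
    by rewrite -aE mulnC exprM sqrtr_sqr ger0_norm// exprn_ge0.
  rewrite -sqrtrM// -[leLHS]ger0_norm -?sqrtr_sqr ?ler_wsqrtr//.
  by apply: sumr_ge0 => j _; rewrite mulr_ge0.
(* Summing [Q] over the [r] slots: for each [j] the slot with the smallest factor alone contributes
   a ratio of at least 1. *)
have main : k * Num.sqrt S <= r%:R * M.
  have -> : r%:R * M = \sum_(q0 < r) M by rewrite sumr_const card_ord mulr_natl.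
  apply: le_trans (ler_sum _ (fun q0 _ => Q q0)).
  rewrite -!mulr_sumr ler_wpM2l ?(ltW k0)// -[leLHS]mulr1 ler_wpM2l ?sqrtr_ge0//.
  rewrite -[leLHS]p1 exchange_big /=; apply: ler_sum => j _.
  have [->|pn] := eqVneq (p j) 0; first by apply: sumr_ge0 => q _; rewrite mul0r.
  have pj : 0 < p j by rewrite lt0r pn p0.
  rewrite -mulr_sumr -[leLHS]mulr1 ler_wpM2l//.
  pose q1 : 'I_r := Ordinal r0.
  case: (@arg_minP _ _ _ q1 predT (fun q => a q (j q)) isT) => q _ qmin.
  rewrite (bigD1 q) //= -[leLHS]addr0 lerD//; last first.
    by apply: sumr_ge0 => q' _; apply: divr_ge0; [by apply: prodr_ge0|by apply: exprn_ge0].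
  rewrite ler_pdivlMr ?exprn_gt0 ?p_gt0// mul1r.
  rewrite -[X in _ ^+ X]card_ord -prodr_const; apply: ler_prod => q' _.
  by rewrite a0 /=; apply: qmin.
have : (k * Num.sqrt S) ^+ 2 <= (r%:R * M) ^+ 2.
  by rewrite lerXn2r ?nnegrE ?mulr_ge0 ?sqrtr_ge0 ?(ltW k0).
have h3 : 0 < 3 ^+ r :> R by rewrite exprn_gt0.
rewrite exprMn sqr_sqrtr// /k [(_ / Num.sqrt _) ^+ 2]exprMn.
rewrite [(Num.sqrt _)^-1 ^+ 2]exprVn sqr_sqrtr ?exprn_ge0//.
rewrite mulrAC ler_pdivrMr// => H.
have -> : (r%:R * 4 / 3) ^+ 2 * 3 ^+ r * M ^+ 2 =
   ((3 / 4) ^+ 2)^-1 * ((r%:R * M) ^+ 2 * 3 ^+ r) :> R by field.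
by rewrite ler_pdivlMl ?exprn_gt0.
Qed.

End HardyLittlewood.

(** * Smoothing by tilted signs *)

Section HyperbolicCosine.
Context {R : realType}.

(** For arguments of size at most [1 / 2] the bound on cosh follows from [exp v <= 1 / (1 - v)]. It
    propagates under doubling because [cosh (2 u) = 2 cosh u ^ 2 - 1 <= cosh u ^ 4]. *)
Lemma avg_expR_sg (c : R) : avg (fun b : bool => expR (sg b * c)) <= expR (2 * c ^+ 2).
Proof.
pose C (c : R) := (expR c + expR (- c)) / 2.
rewrite avg_bool /sg expr1 expr0 mul1r mulN1r [X in X / _]addrC -/(C c).
have loc (u : R) : `|u| <= 2^-1 -> C u <= expR (2 * u ^+ 2).
  move=> hu.
  have hu1 : u <= 2^-1 := le_trans (ler_norm _) hu.
  have hu2 : - u <= 2^-1 by apply: le_trans (ler_norm _) _; rewrite normrN.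
  have ub (v : R) : v <= 2^-1 -> expR v <= (1 - v)^-1.
    move=> hv; rewrite -[v in leLHS]opprK expRN lef_pV2 ?posrE ?expR_gt0//; last lra.
    exact: expR_ge1Dx.
  apply: le_trans (expR_ge1Dx _).
  have h1 := ub _ hu1; have h2 := ub _ hu2; rewrite opprK in h2.
  have u2 : u ^+ 2 <= 1 / 4 by nra.
  apply: (@le_trans _ _ (1 - u ^+ 2)^-1).
    have -> : (1 - u ^+ 2)^-1 = ((1 - u)^-1 + (1 + u)^-1) / 2.
      have e1 : 1 - u != 0 by rewrite gt_eqF//; lra.
      have e2 : 1 + u != 0 by rewrite gt_eqF//; lra.
      have e3 : 1 - u ^+ 2 != 0 by rewrite gt_eqF//; lra.
      by field; rewrite ?e1 ?e2 ?e3.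
    by rewrite /C; lra.
  rewrite -[(_)^-1]mul1r ler_pdivrMr; last lra.
  have : 0 <= u ^+ 2 by exact: sqr_ge0.
  by set w := u ^+ 2 in u2 *; nra.
have dbl (u : R) : C u <= expR (2 * u ^+ 2) -> C (2 * u) <= expR (2 * (2 * u) ^+ 2).
  move=> h; have -> : 2 * (2 * u) ^+ 2 = 4 * (2 * u ^+ 2) by ring.
  rewrite expRM_natl.
  have C0 : 0 <= C u by rewrite /C divr_ge0// addr_ge0// expR_ge0.
  apply: (@le_trans _ _ (C u ^+ 4)); last first.
    by rewrite lerXn2r ?nnegrE ?expR_ge0.
  have -> : C (2 * u) = 2 * C u ^+ 2 - 1.
    rewrite /C -mulrN !expRM_natl.
    have := expRN u; set a := expR u; set b := expR (- u) => ba.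
    have ab : a * b = 1 by rewrite ba divff// gt_eqF// expR_gt0.
    by rewrite -[X in _ - X]ab; field.
  have := sqr_ge0 (C u ^+ 2 - 1); nra.
have [n] : exists n, `|c| <= 2 ^+ n / 2.
  exists (Num.bound (`|c| * 2)).
  rewrite ler_pdivlMr//; apply: le_trans (ltW (archi_boundP _)) _; first by rewrite mulr_ge0.
  by rewrite -natrX ler_nat ltnW// ltn_expl.
elim: n c => [|n IH] c hc; first by apply: loc; rewrite expr0 mul1r in hc.
have -> : c = 2 * (c / 2) by field.
apply: dbl; apply: IH; rewrite normrM [ `|2^-1| ]ger0_norm// ler_pM2r//.
by move: hc; rewrite exprS mulrAC divff// mul1r.
Qed.

Lemma avg_expR_signs n (c : 'I_n -> R) :
  avg (fun e : {ffun 'I_n -> bool} => expR (\sum_k sg (e k) * c k)) <=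
  expR (2 * \sum_k c k ^+ 2).
Proof.
under eq_avg => e do rewrite expR_sum.
rewrite (avg_prod _ _ (fun k b => expR (sg b * c k))) mulr_sumr expR_sum.
apply: ler_prod => k _; rewrite avg_ge0/=; last by move=> b; exact: expR_ge0.
exact: avg_expR_sg.
Qed.

End HyperbolicCosine.

(** * Moments of multilinear forms at independent vectors *)

Section MultilinearForms.
Context {R : realType} {r : nat} {I : finType}.
Implicit Types (T : {ffun 'I_r -> I} -> R) (y : 'I_r -> I -> R).

Definition mform T y : R := \sum_j T j * \prod_q y q (j q).

Lemma sum_mform (B : finType) (g : 'I_r -> B -> R) T (V : 'I_r -> B -> I -> R) :
  \sum_(b : {ffun 'I_r -> B}) (\prod_q g q (b q)) * mform T (fun q => V q (b q)) =
  mform T (fun q i => \sum_b g q b * V q b i).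
Proof.
rewrite /mform; under eq_bigr => b _ do rewrite mulr_sumr.
rewrite exchange_big /=; apply: eq_bigr => j _.
rewrite bigA_distr_bigA mulr_sumr; apply: eq_bigr => b _.
by rewrite big_split /=; ring.
Qed.

(** The expanded square factors over the slots, so the law in slot [q] enters only through its
    second-moment matrix. Two families with the same matrices therefore give the same second
    moment. *)
Lemma sum_mform_sqr (B : finType) (g : 'I_r -> B -> R) T (V : 'I_r -> B -> I -> R) :
  \sum_(b : {ffun 'I_r -> B}) (\prod_q g q (b q)) * mform T (fun q => V q (b q)) ^+ 2 =
  \sum_j \sum_j' T j * T j' * \prod_q \sum_b g q b * (V q b (j q) * V q b (j' q)).
Proof.
transitivity (\sum_(b : {ffun 'I_r -> B}) \sum_j \sum_j'
    T j * T j' * \prod_q (g q (b q) * (V q (b q) (j q) * V q (b q) (j' q)))).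
  apply: eq_bigr => b _; rewrite expr2 /mform big_distrlr /= mulr_sumr.
  apply: eq_bigr => j _; rewrite mulr_sumr; apply: eq_bigr => j' _.
  by rewrite !big_split /=; ring.
rewrite exchange_big /=; apply: eq_bigr => j _.
rewrite exchange_big /=; apply: eq_bigr => j' _.
by rewrite bigA_distr_bigA mulr_sumr.
Qed.

Lemma mform_scale T y (c : R) : mform T (fun q i => c * y q i) = c ^+ r * mform T y.
Proof.
rewrite /mform mulr_sumr; apply: eq_bigr => j _.
by rewrite big_split /= prodr_const card_ord; ring.
Qed.

End MultilinearForms.

(** * Biased product measures on signs *)

Section TiltedSigns.
Context {R : realType}.

(* Density, with respect to uniform signs, of independent signs with means [t]. *)
Definition tilt {A : finType} (t : A -> R) (e : {ffun A -> bool}) : R :=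
  \prod_a (1 + sg (e a) * t a).

Variables (A : finType) (t : A -> R).

Lemma avg_tilt_prod (h : A -> bool -> R) :
  avg (fun e => tilt t e * \prod_a h a (e a)) =
  \prod_a avg (fun b => (1 + sg b * t a) * h a b).
Proof.
rewrite -avg_prod; apply: eq_avg => e.
by rewrite /tilt -big_split.
Qed.

Lemma avg_tilt1 : avg (tilt t) = 1.
Proof.
have := avg_tilt_prod (fun _ _ => 1).
rewrite (eq_avg _ _ (tilt t)); last by move=> e; rewrite big1 ?mulr1.
by move=> ->; apply: big1 => a _; rewrite avg_bool /sg expr1 expr0; field.
Qed.

Lemma avg_tilt_sg a : avg (fun e => tilt t e * sg (e a)) = t a.
Proof.
have := avg_tilt_prod (fun c b => if c == a then sg b else 1).
rewrite (eq_avg _ _ (fun e => tilt t e * sg (e a))); last first.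
  by move=> e; rewrite (bigD1 a) //= eqxx big1 ?mulr1// => c /negPf ->.
move=> ->; rewrite (bigD1 a) //= eqxx big1 ?mulr1; last first.
  by move=> c /negPf ->; rewrite avg_bool /sg expr1 expr0; field.
by rewrite avg_bool /sg expr1 expr0; field.
Qed.

Lemma avg_tilt_sg2 a b : avg (fun e => tilt t e * (sg (e a) * sg (e b))) =
  t a * t b + (a == b)%:R * (1 - t a ^+ 2).
Proof.
have [<-|ab] := eqVneq a b.
  rewrite (eq_avg _ _ (tilt t)); last by move=> e; rewrite -expr2 sqr_sg mulr1.
  by rewrite avg_tilt1 ?eqxx mulr1n; ring.
have := avg_tilt_prod (fun c u => if (c == a) || (c == b) then sg u else 1).
rewrite (eq_avg _ _ (fun e => tilt t e * (sg (e a) * sg (e b)))); last first.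
  move=> e; rewrite (bigD1 a) //= eqxx (bigD1 b) //=; last by rewrite eq_sym.
  by rewrite eqxx orbT big1 ?mulr1// => c /andP[/negPf -> /negPf ->].
move=> ->; rewrite (bigD1 a) //= (bigD1 b) //=; last by rewrite eq_sym.
rewrite !eqxx orbT /= big1 ?mulr1; last first.
  by move=> c /andP[/negPf -> /negPf ->] /=; rewrite avg_bool /sg expr1 expr0; field.
by rewrite !avg_bool /sg expr1 expr0 mul0r addr0; field.
Qed.

Lemma tilt_ge0 e : (forall a, `|t a| <= 1) -> 0 <= tilt t e.
Proof.
move=> t1; apply: prodr_ge0 => a _.
have : `|sg (e a) * t a| <= 1 by rewrite normrM /sg normr_sign mul1r.
by rewrite ler_norml => /andP[+ _]; lra.
Qed.

(** The log-density is at most a linear function of the signs, whose mean under the tilted law is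
    [\sum_a t a ^ 2]; this is what controls the relative entropy. *)
Lemma tilt_le_expR e : (forall a, `|t a| <= 1) ->
  tilt t e <= expR (\sum_a sg (e a) * t a).
Proof.
move=> t1; rewrite expR_sum; apply: ler_prod => a _; rewrite expR_ge1Dx andbT.
have : `|sg (e a) * t a| <= 1 by rewrite normrM /sg normr_sign mul1r.
by rewrite ler_norml => /andP[+ _]; lra.
Qed.

End TiltedSigns.

(** * Coordinates as rescaled sums of biased signs *)

Section BlockSums.
Context {R : realType} {I L : finType}.
Variables (s : R) (x : I -> R).
Hypothesis sL : s * #|L|%:R != 0.

Definition block (e : {ffun I * L -> bool}) (i : I) : R := s * \sum_l sg (e (i, l)).

(** The common mean of the signs in block [a.1], chosen so that the block sum has mean [x a.1]. *)
Definition mean_shift (a : I * L) : R := x a.1 / (s * #|L|%:R).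

Definition block_var (i : I) : R :=
  s ^+ 2 * #|L|%:R * (1 - (x i / (s * #|L|%:R)) ^+ 2).

Lemma avg_block i : avg (fun e => tilt mean_shift e * block e i) = x i.
Proof.
rewrite (eq_avg _ _ (fun e => s * \sum_l tilt mean_shift e * sg (e (i, l)))); last first.
  by move=> e; rewrite /block mulrCA; congr (_ * _); rewrite mulr_sumr.
rewrite avgZ avg_sum (eq_bigr (fun=> x i / (s * #|L|%:R))); last first.
  by move=> l _; exact: avg_tilt_sg.
move: sL; rewrite mulf_eq0 negb_or => /andP[s0 L0].
rewrite sumr_const -[_ *+ _]mulr_natr; field; by rewrite s0 L0.
Qed.

Lemma avg_block2 i i' : avg (fun e => tilt mean_shift e * (block e i * block e i')) =
  x i * x i' + (i == i')%:R * block_var i.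
Proof.
move: sL; rewrite mulf_eq0 negb_or => /andP[s0 L0].
rewrite (eq_avg _ _ (fun e => s ^+ 2 *
    \sum_l \sum_l' tilt mean_shift e * (sg (e (i, l)) * sg (e (i', l'))))); last first.
  move=> e; rewrite /block.
  rewrite (_ : tilt _ e * _ = s ^+ 2 * (tilt mean_shift e *
    ((\sum_l sg (e (i, l))) * (\sum_l sg (e (i', l)))))); last by ring.
  congr (_ * _); rewrite mulr_suml mulr_sumr; apply: eq_bigr => l _.
  by rewrite mulr_sumr mulr_sumr.
rewrite avgZ avg_sum.
pose u := x i / (s * #|L|%:R).
rewrite (eq_bigr (fun=> #|L|%:R * (u * (x i' / (s * #|L|%:R))) + (i == i')%:R * (1 - u ^+ 2))).
  by rewrite sumr_const -[_ *+ _]mulr_natr /block_var -/u /u; field; rewrite s0 L0.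
move=> l _; rewrite avg_sum.
rewrite (eq_bigr (fun l' => u * (x i' / (s * #|L|%:R)) + (l == l')%:R * ((i == i')%:R * (1 - u ^+ 2)))).
  rewrite big_split /= sumr_const -[_ *+ _]mulr_natl; congr (_ + _).
  rewrite (bigD1 l) //= eqxx big1 ?addr0 ?mul1r// => l' /negPf.
  by rewrite eq_sym => ->; rewrite mul0r.
move=> l' _; rewrite avg_tilt_sg2 /mean_shift /= -/u xpair_eqE.
by case: eqP; case: eqP => /= _ _; rewrite ?(mul0r, mul1r).
Qed.

Lemma sum_mean_shift : \sum_a mean_shift a ^+ 2 = (\sum_i x i ^+ 2) / (s ^+ 2 * #|L|%:R).
Proof.
move: sL; rewrite mulf_eq0 negb_or => /andP[s0 L0].
have -> : \sum_a mean_shift a ^+ 2 = \sum_i \sum_l mean_shift (i, l) ^+ 2.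
  by rewrite pair_bigA; apply: eq_bigr => -[].
rewrite mulr_suml; apply: eq_bigr => i _.
rewrite /mean_shift /= sumr_const -[_ *+ _]mulr_natr; field; by rewrite s0 L0.
Qed.

End BlockSums.

(** * Smoothing independently in all slots *)

Section ProductTilt.
Context {R : realType} {r : nat} {I L : finType}.
Variables (s : R) (x : 'I_r -> I -> R).
Hypothesis sL : s * #|L|%:R != 0.

Local Notation signs := {ffun 'I_r -> {ffun I * L -> bool}}.

Definition prod_tilt (e : signs) : R := \prod_q tilt (mean_shift s (x q)) (e q).

Definition blocks (e : signs) (q : 'I_r) (i : I) : R := block s (e q) i.

Lemma avg_ffunE (Q B : finType) (F : {ffun Q -> B} -> R) :
  avg F = \sum_e (\prod_(q : Q) #|B|%:R^-1) * F e.
Proof.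
by rewrite -mulr_sumr prodr_const exprVn mulrC /avg card_ffun natrX.
Qed.

Lemma avg_prod_tilt_mform T :
  avg (fun e => prod_tilt e * mform T (blocks e)) = mform T x.
Proof.
rewrite avg_ffunE.
transitivity (\sum_(e : signs)
    (\prod_q (tilt (mean_shift s (x q)) (e q) / #|{ffun I * L -> bool}|%:R)) *
    mform T (fun q => block s (e q))).
  by apply: eq_bigr => e _; rewrite big_split /= mulrA [X in X * _]mulrC.
rewrite (sum_mform _ (fun q b => tilt (mean_shift s (x q)) b / #|{ffun I * L -> bool}|%:R)
  T (fun q b => block s b)).
rewrite /mform; apply: eq_bigr => j _; congr (_ * _); apply: eq_bigr => q _.
rewrite -[RHS](avg_block _ _ sL) /avg mulr_suml; apply: eq_bigr => b _.
by rewrite mulrAC.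
Qed.

(* The second moment is the squared Frobenius norm of [T] contracted, in every slot [q],
   with the vectors [x q] and [sqrt (var i) e_i]. *)
Definition energy_vector (q : 'I_r) (b : option I) (i : I) : R :=
  if b is Some i0 then (i == i0)%:R * Num.sqrt (block_var (L := L) s (x q) i0) else x q i.

Lemma avg_prod_tilt_mform_sqr T : (forall q i, 0 <= block_var (L := L) s (x q) i) ->
  avg (fun e => prod_tilt e * mform T (blocks e) ^+ 2) =
  \sum_(b : {ffun 'I_r -> option I}) mform T (fun q => energy_vector q (b q)) ^+ 2.
Proof.
move=> var0; rewrite avg_ffunE.
transitivity (\sum_(e : signs)
    (\prod_q (tilt (mean_shift s (x q)) (e q) / #|{ffun I * L -> bool}|%:R)) *
    mform T (fun q => block s (e q)) ^+ 2).
  by apply: eq_bigr => e _; rewrite big_split /= mulrA [X in X * _]mulrC.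
rewrite (sum_mform_sqr _ (fun q b => tilt (mean_shift s (x q)) b / #|{ffun I * L -> bool}|%:R)
  T (fun q b => block s b)).
transitivity (\sum_(b : {ffun 'I_r -> option I})
    (\prod_(q < r) 1) * mform T (fun q => energy_vector q (b q)) ^+ 2); last first.
  by apply: eq_bigr => b _; rewrite big1 ?mul1r.
(* The tilted blocks and the energy vectors with unit weights have the same second-moment matrix in
   slot [q]: the rank-one matrix of [x q] plus the diagonal matrix of variances. *)
rewrite (sum_mform_sqr _ (fun _ _ => 1) T energy_vector).
apply: eq_bigr => j _; apply: eq_bigr => j' _; congr (_ * _); apply: eq_bigr => q _.
transitivity (x q (j q) * x q (j' q) + (j q == j' q)%:R * block_var (L := L) s (x q) (j q)).
  rewrite -(avg_block2 _ _ sL) /avg mulr_suml; apply: eq_bigr => b _.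
  by rewrite mulrAC.
rewrite (bigD1 None) //= mul1r; congr (_ + _).
rewrite (bigD1 (Some (j q))) //= big1 ?addr0 => [|[i|//] /=].
  by rewrite eqxx [j' q == _]eq_sym -{1}[block_var _ _ _]sqr_sqrtr// mulr1n; ring.
by rewrite (inj_eq Some_inj) eq_sym => /negPf ->; rewrite !mul0r mulr0.
Qed.

(** Hardy-Littlewood for the tensor indexed by [option I] whose entries are the values of [T] at the
    energy vectors. Its test vectors [z] recombine, by multilinearity, into the arguments of [T] in
    the hypothesis. *)
Lemma avg_prod_tilt_mform_sqr_le T M : (0 < r)%N -> 0 <= M ->
  (forall q i, 0 <= block_var (L := L) s (x q) i) ->
  (forall z : 'I_r -> option I -> R, (forall q, \sum_b `|z q b| ^+ (2 * r) <= 1) ->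
    mform T (fun q i => z q None * x q i +
      z q (Some i) * Num.sqrt (block_var (L := L) s (x q) i)) <= M) ->
  avg (fun e => prod_tilt e * mform T (blocks e) ^+ 2) <=
  (r%:R * 4 / 3) ^+ 2 * 3 ^+ r * M ^+ 2.
Proof.
move=> r0 M0 var0 hM; rewrite avg_prod_tilt_mform_sqr//.
apply: hardy_littlewood => // z hz.
apply: le_trans (hM z hz); rewrite le_eqVlt; apply/orP; left; apply/eqP.
under eq_bigr => b _ do rewrite mulrC.
rewrite (sum_mform _ z T energy_vector); apply: eq_bigr => j _; congr (_ * _).
apply: eq_bigr => q _; rewrite (bigD1 None) //=; congr (_ + _).
rewrite (bigD1 (Some (j q))) //= big1 ?addr0 => [|[i|//] /=].
  by rewrite eqxx mul1r.
by rewrite (inj_eq Some_inj) eq_sym => /negPf ->; rewrite mul0r mulr0.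
Qed.

Lemma avg_prod_tilt_sg q a :
  avg (fun e => prod_tilt e * sg (e q a)) = mean_shift s (x q) a.
Proof.
rewrite (eq_avg _ _ (fun e : signs => \prod_q' (tilt (mean_shift s (x q')) (e q') *
   (if q' == q then sg (e q' a) else 1)))); last first.
  move=> e; rewrite big_split /=; congr (_ * _).
  by rewrite (bigD1 q) //= eqxx big1 ?mulr1// => q' /negPf ->.
rewrite (avg_prod _ _ (fun q' b => tilt (mean_shift s (x q')) b *
  (if q' == q then sg (b a) else 1))) (bigD1 q) //= eqxx avg_tilt_sg.
rewrite big1 ?mulr1// => q' /negPf ->.
by rewrite -[RHS](avg_tilt1 (I * L)%type (mean_shift s (x q'))); apply: eq_avg => b; rewrite mulr1.
Qed.

(* A change of measure: since [f <= exp l], one has [f h <= f l + exp h] pointwise. *)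
Lemma avg_prod_tilt_le (h : signs -> R) :
  (forall q i, `|x q i| <= `|s * #|L|%:R|) ->
  avg (fun e => prod_tilt e * h e) <=
  \sum_q \sum_a mean_shift (L := L) s (x q) a ^+ 2 + avg (fun e => expR (h e)).
Proof.
move=> xs.
have t1 q (a : I * L) : `|mean_shift s (x q) a| <= 1.
  by rewrite /mean_shift normrM normfV ler_pdivrMr ?normr_gt0// mul1r.
pose l (e : signs) := \sum_q \sum_a sg (e q a) * mean_shift s (x q) a.
(* The entropy term is the tilted mean of the linear majorant [l] of the log-density. *)
have -> : \sum_q \sum_a mean_shift (L := L) s (x q) a ^+ 2 =
    avg (fun e => prod_tilt e * l e).
  rewrite (eq_avg _ (fun e => _ * l e) (fun e => \sum_q \sum_a
    mean_shift s (x q) a * (prod_tilt e * sg (e q a)))).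
    rewrite avg_sum; apply: eq_bigr => q _; rewrite avg_sum; apply: eq_bigr => a _.
    by rewrite avgZ avg_prod_tilt_sg expr2.
  move=> e; rewrite mulr_sumr; apply: eq_bigr => q _.
  by rewrite mulr_sumr; apply: eq_bigr => a _; ring.
rewrite -avgD; apply: le_avg => e.
have f0 : 0 <= prod_tilt e by apply: prodr_ge0 => q _; exact: tilt_ge0.
have fl : prod_tilt e <= expR (l e).
  rewrite expR_sum; apply: ler_prod => q _.
  by rewrite tilt_ge0//= tilt_le_expR.
rewrite -lerBlDl -mulrBr.
apply: (@le_trans _ _ (prod_tilt e * expR (h e - l e))).
  by rewrite ler_wpM2l//; apply: le_trans (expR_ge1Dx _); rewrite lerDr.
rewrite expRD expRN mulrCA ler_piMr ?expR_ge0// ler_pdivrMr ?expR_gt0//.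
by rewrite mul1r.
Qed.

End ProductTilt.

(** * The PAC-Bayes bound *)

Section PacBayes.
Context {R : realType} {r n : nat} {I : finType} (L : finType).
Variables (s lam : R) (T : 'I_n -> {ffun 'I_r -> I} -> R).
Local Notation signs := {ffun 'I_r -> {ffun I * L -> bool}}.

(** An exponential moment under fair signs, hence independent of the point [x]. The penalty
    [4 lam ^ 2] is exactly what the sub-Gaussian bound [exp (2 c ^ 2)] requires for the square to
    have mean at most 1. *)
Definition partition_function (c : 'I_n -> R) : R :=
  avg (fun e : signs => expR (lam * \sum_k c k * mform (T k) (blocks s e)
    - 4 * lam ^+ 2 * \sum_k mform (T k) (blocks s e) ^+ 2)).

Lemma partition_function_ge0 c : 0 <= partition_function c.
Proof. by apply: avg_ge0 => e; exact: expR_ge0. Qed.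

(** Jensen moves the square inside the average over [e]. For fixed [e] the average over [b] is then
    at most [exp (8 lam ^ 2 V)], which the squared penalty cancels. *)
Lemma avg_partition_function_sqr :
  avg (fun b : {ffun 'I_n -> bool} => partition_function (fun k => sg (b k)) ^+ 2) <= 1.
Proof.
have C : (0 < #|{: signs}|)%N by rewrite !card_ffun_gt0 ?card_bool.
apply: le_trans (le_avg _ _ _ (fun b => sqr_avg_le _ _ C)) _.
rewrite avgC -[leRHS](avg_cst _ 1 C); apply: le_avg => e.
set V := \sum_k mform (T k) _ ^+ 2.
rewrite (eq_avg _ _ (fun b : {ffun 'I_n -> bool} => expR (- (8 * lam ^+ 2 * V)) *
  expR (\sum_k sg (b k) * (2 * lam * mform (T k) (blocks s e))))); last first.
  move=> b; rewrite -expRM_natl -expRD; congr expR.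
  have -> : \sum_k sg (b k) * (2 * lam * mform (T k) (blocks s e)) =
      2 * lam * \sum_k sg (b k) * mform (T k) (blocks s e).
    by rewrite mulr_sumr; apply: eq_bigr => k _; ring.
  by rewrite -/V; ring.
rewrite avgZ expRN mulrC ler_pdivrMr ?expR_gt0// mul1r.
apply: le_trans (avg_expR_signs _ _) _.
rewrite ler_expR (eq_bigr (fun k => 4 * lam ^+ 2 * mform (T k) (blocks s e) ^+ 2)).
  by rewrite -mulr_sumr -/V le_eqVlt; apply/orP; left; apply/eqP; ring.
by move=> k _; ring.
Qed.

(** Change of measure applied to the exponent of [partition_function]: its linear part averages to
    the value at [x], so on the right [x] enters only through the energy and the entropy. *)
Lemma pac_bayes (x : 'I_r -> I -> R) (c : 'I_n -> R) :
  s * #|L|%:R != 0 -> (forall q i, `|x q i| <= `|s * #|L|%:R|) ->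
  lam * \sum_k c k * mform (T k) x <=
  4 * lam ^+ 2 * \sum_k avg (fun e => prod_tilt (L := L) s x e * mform (T k) (blocks s e) ^+ 2)
  + \sum_q \sum_a mean_shift (L := L) s (x q) a ^+ 2 + partition_function c.
Proof.
move=> sL xs.
have := avg_prod_tilt_le s x sL (fun e => lam * \sum_k c k * mform (T k) (blocks s e)
    - 4 * lam ^+ 2 * \sum_k mform (T k) (blocks s e) ^+ 2) xs.
rewrite -/(partition_function c) => H; rewrite -addrA -lerBlDl; apply: le_trans H.
rewrite (eq_avg _ _ (fun e => lam * \sum_k c k * (prod_tilt s x e * mform (T k) (blocks s e)) +
  (- (4 * lam ^+ 2)) * \sum_k prod_tilt s x e * mform (T k) (blocks s e) ^+ 2)); last first.
  move=> e; rewrite mulrBr mulNr; congr (_ - _).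
    by rewrite mulrCA; congr (_ * _); rewrite mulr_sumr; apply: eq_bigr => k _; ring.
  by rewrite mulrCA; congr (_ * _); rewrite mulr_sumr.
rewrite avgD !avgZ !avg_sum mulNr le_eqVlt; apply/orP; left; apply/eqP.
congr (_ * _ - _); apply: eq_bigr => k _.
by rewrite avgZ avg_prod_tilt_mform.
Qed.

End PacBayes.

(** * The injective norm *)

Section PowerSums.
Context {R : realType}.

Lemma one_powR (a : R) : 1 `^ a = 1.
Proof. by rewrite powR1. Qed.

Lemma powR_le_add1 (a b w : R) : 0 <= a -> a <= b -> 0 <= w -> w `^ a <= 1 + w `^ b.
Proof.
move=> a0 ab w0; have [w1|w1] := leP w 1.
  have h : w `^ a <= 1 `^ a by rewrite ge0_ler_powR ?nnegrE.
  by rewrite powR1 in h; apply: le_trans h _; rewrite lerDl powR_ge0.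
apply: (@le_trans _ _ (w `^ b)); last by rewrite lerDr.
by rewrite ler_powR// ltW.
Qed.

(** Hölder's inequality up to a factor 2: rescale the entries by [D ^ (1 / b)], apply
    [w ^ a <= 1 + w ^ b] and sum. *)
Lemma sum_powR_le (I : finType) (a b : R) (z : I -> R) : (0 < #|I|)%N ->
  0 <= a -> a <= b -> 0 < b -> \sum_i `|z i| `^ b <= 1 ->
  \sum_i `|z i| `^ a <= 2 * #|I|%:R `^ (1 - a / b).
Proof.
move=> I0 a0 ab b0 hz; set D : R := #|I|%:R.
have D0 : 0 < D by rewrite ltr0n.
have Db : (D `^ b^-1) `^ b = D by rewrite -powRrM mulVf ?powRr1 ?gt_eqF ?ltW.
apply: (@le_trans _ _ (\sum_i D `^ (- (a / b)) * (1 + D * `|z i| `^ b))).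
  apply: ler_sum => i _.
  have -> : `|z i| `^ a = D `^ (- (a / b)) * (D `^ b^-1 * `|z i|) `^ a.
    rewrite powRM ?powR_ge0// mulrA -powRrM [b^-1 * a]mulrC powRN mulVf ?mul1r//.
    by rewrite gt_eqF ?powR_gt0.
  rewrite ler_wpM2l ?powR_ge0//.
  apply: le_trans (powR_le_add1 _ _ _ a0 ab _) _; first by rewrite mulr_ge0 ?powR_ge0.
  by rewrite powRM ?powR_ge0// Db.
rewrite -mulr_sumr big_split /= sumr_const -mulr_sumr.
have -> : D `^ (1 - a / b) = D `^ (- (a / b)) * D.
  by rewrite addrC powRD ?powRr1 ?ltW//; apply/implyP => _; rewrite gt_eqF.
rewrite mulrCA ler_wpM2l ?powR_ge0// -[_ *+ _]/D.
have : D * \sum_i `|z i| `^ b <= D by rewrite ler_piMr// ltW.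
lra.
Qed.

(** The left argument is at most a quarter of the larger of the two absolute values, and
    [(1 / 4) ^ p <= 1 / 4]. *)
Lemma powR_avg_le (p u v : R) : 1 <= p ->
  `|(u + v) / 8| `^ p <= (`|u| `^ p + `|v| `^ p) / 4.
Proof.
move=> p1; have p0 : 0 <= p by apply: le_trans p1.
wlog uv : u v / `|u| <= `|v|.
  move=> h; have [/h//|/ltW/h] := leP `|u| `|v|.
  by rewrite [v + u]addrC [`|v| `^ p + _]addrC.
have h : `|(u + v) / 8| <= 4^-1 * `|v|.
  rewrite normrM [`|8^-1|]ger0_norm//; have := ler_normD u v; lra.
apply: (@le_trans _ _ ((4^-1 * `|v|) `^ p)).
  by rewrite ge0_ler_powR ?nnegrE ?mulr_ge0.
rewrite powRM//; apply: (@le_trans _ _ (4^-1 * `|v| `^ p)); last first.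
  by have := powR_ge0 `|u| p; lra.
rewrite ler_wpM2r ?powR_ge0// -[leRHS]powRr1//; apply: ger_powR => //.
by apply/andP; split; lra.
Qed.

End PowerSums.

Section InjectiveNormBounds.
Context {R : realType} {r d : nat}.
Variable p : R.
Hypothesis p1 : 1 <= p.

Let p0 : 0 < p. Proof. exact: lt_le_trans p1. Qed.

Lemma tensor_innerE (T : tensor R r d) (x : 'I_r -> 'rV[R]_d) :
  tensor_inner T (elementary_tensor x) = mform T (fun q i => x q 0 i).
Proof. by apply: eq_bigr => j _; rewrite ffunE. Qed.

Lemma lp_norm_le1 (x : 'rV[R]_d) : (lp_norm p x <= 1) = (\sum_i `|x 0 i| `^ p <= 1).
Proof.
have S0 : 0 <= \sum_(i < d) `|x 0 i| `^ p by apply: sumr_ge0 => i _; exact: powR_ge0.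
apply/idP/idP; rewrite /lp_norm => h.
  rewrite -[leLHS]powRr1// -[X in _ `^ X](mulVf (lt0r_neq0 p0)) powRrM -[leRHS](one_powR p).
  by rewrite ge0_ler_powR ?nnegrE ?powR_ge0 ?(ltW p0).
by rewrite -[leRHS](one_powR p^-1) ge0_ler_powR ?nnegrE ?invr_ge0 ?(ltW p0).
Qed.

Lemma ball_coord_le1 (z : 'I_d -> R) : \sum_i `|z i| `^ p <= 1 -> forall i, `|z i| <= 1.
Proof.
move=> hz i; rewrite leNgt; apply/negP => zi.
have : 1 < `|z i| `^ p.
  by rewrite -[ltLHS](one_powR p) gt0_ltr_powR ?nnegrE.
rewrite ltNge => /negP; apply; apply: le_trans hz.
by rewrite (bigD1 i) //= lerDl sumr_ge0// => k _; exact: powR_ge0.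
Qed.

Lemma mform_le_injective_norm (T : tensor R r d) (z : 'I_r -> 'I_d -> R) :
  (forall q, \sum_i `|z q i| `^ p <= 1) -> mform T z <= injective_norm p T.
Proof.
move=> hz; rewrite /injective_norm; set E := (X in sup X).
have Ez : E (mform T z).
  exists (fun q => \row_i z q i) => /=.
    by move=> q; rewrite lp_norm_le1; under eq_bigr do rewrite mxE.
  rewrite tensor_innerE; apply: eq_bigr => j _; congr (_ * _).
  by apply: eq_bigr => q _; rewrite mxE.
apply: sup_upper_bound => //; split; first by exists (mform T z).
(* Boundedness is essential for [sup] to be an upper bound; it holds because the coordinates of
   points of the ball are at most 1 in absolute value. *)
exists (\sum_j `|T j|) => _ [x /= hx <-]; rewrite tensor_innerE.
apply: ler_sum => j _; apply: le_trans (ler_norm _) _.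
rewrite normrM ler_piMr// normr_prod; apply: prodr_ile1 => q _.
rewrite normr_ge0 /=; apply: (ball_coord_le1 (fun i => x q 0 i)).
by rewrite -lp_norm_le1.
Qed.

Lemma injective_norm_le (T : tensor R r d) M :
  (forall z : 'I_r -> 'I_d -> R, (forall q, \sum_i `|z q i| `^ p <= 1) -> mform T z <= M) ->
  injective_norm p T <= M.
Proof.
move=> hM; apply: ge_sup.
  exists (tensor_inner T (elementary_tensor (fun=> 0))); exists (fun=> 0) => //= q.
  by rewrite lp_norm_le1 big1// => i _; rewrite mxE normr0 powR0// gt_eqF.
move=> _ [x /= hx <-]; rewrite tensor_innerE; apply: hM => q.
by rewrite -lp_norm_le1.
Qed.

Lemma injective_norm_ge0 (T : tensor R r d) : (0 < r)%N -> 0 <= injective_norm p T.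
Proof.
move=> r0; apply: le_trans (mform_le_injective_norm T (fun _ _ => 0) _).
  rewrite /mform big1// => j _.
  by rewrite (bigD1 (Ordinal r0)) //= mul0r mulr0.
by move=> q; rewrite big1// => i _; rewrite normr0 powR0// gt_eqF.
Qed.

Lemma mform_sum n (c : 'I_n -> R) (T : 'I_n -> tensor R r d) z :
  mform (\sum_k c k *: T k : tensor R r d) z = \sum_k c k * mform (T k) z.
Proof.
rewrite /mform; under [RHS]eq_bigr => k _ do rewrite mulr_sumr.
rewrite exchange_big /=; apply: eq_bigr => j _.
rewrite sum_ffunE mulr_suml; apply: eq_bigr => k _.
by rewrite ffunE mulrA.
Qed.

End InjectiveNormBounds.

(** * The upper bound for averages over sign patterns *)

Section FiniteType2.
Context {R : realType} {r d : nat}.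
Variable p : R.
Hypotheses (p2 : 2 <= p) (r_gt0 : (0 < r)%N) (d_gt0 : (0 < d)%N).

Let m : R := Num.max p (2 * r)%:R.
Let D : R := d%:R.

(* [tau] is the standard deviation of each coordinate of the smoothing noise. *)
Let tau : R := D `^ (m^-1 - p^-1).
Let s : R := tau / Num.sqrt D.

Let p1 : 1 <= p. Proof. by apply: le_trans p2; rewrite ler1n. Qed.
Let p0 : 0 < p. Proof. exact: lt_le_trans p1. Qed.
Let pm : p <= m. Proof. by rewrite /m le_max lexx. Qed.
Let rm : (2 * r)%:R <= m. Proof. by rewrite /m le_max lexx orbT. Qed.
Let m0 : 0 < m. Proof. exact: lt_le_trans pm. Qed.
Let D0 : 0 < D. Proof. by rewrite ltr0n. Qed.
Let Dimp (c : bool) : c ==> (D != 0). Proof. by rewrite (gt_eqF D0) implybT. Qed.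
Let D1 : 1 <= D. Proof. by rewrite ler1n. Qed.
Let tau0 : 0 < tau. Proof. exact: powR_gt0. Qed.

Let sqrtD0 : 0 < Num.sqrt D. Proof. by rewrite sqrtr_gt0. Qed.

Let sD : s * D = tau * Num.sqrt D.
Proof.
rewrite /s -[X in _ * X = _](sqr_sqrtr (ltW D0)) expr2 mulrA divfK//.
by rewrite gt_eqF.
Qed.

(** The largest value [s * D] of a block must dominate every coordinate of the ball, so that the
    tilts are densities. The exponent [1 / 2 + 1 / m - 1 / p] is nonnegative because [p >= 2]. *)
Let sD_ge1 : 1 <= s * D.
Proof.
rewrite sD -powR12_sqrt ?(ltW D0)// /tau -powRD; last exact: Dimp.
rewrite -[leLHS](powRr0 D) ler_powR//.
have : p^-1 <= 2^-1 by rewrite lef_pV2 ?posrE.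
have : 0 < m^-1 by rewrite invr_gt0.
lra.
Qed.

Let s2D : s ^+ 2 * D = tau ^+ 2.
Proof. by rewrite /s exprMn exprVn sqr_sqrtr ?(ltW D0)// divfK ?gt_eqF. Qed.

Section Ball.
Variable x : 'I_r -> 'I_d -> R.
Hypothesis hx : forall q, \sum_i `|x q i| `^ p <= 1.

Let x1 q i : `|x q i| <= 1. Proof. exact: (ball_coord_le1 p p1 _ (hx q)). Qed.

Let var_bounds q i : 0 <= block_var (L := 'I_d) s (x q) i <= tau ^+ 2.
Proof.
rewrite /block_var card_ord -/D s2D.
have : (x q i / (s * D)) ^+ 2 <= 1.
  rewrite -real_normK ?num_real// -(expr1n _ 2) lerXn2r ?nnegrE//.
  have sD0 : 0 < s * D by apply: lt_le_trans sD_ge1.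
  rewrite normrM normfV (gtr0_norm sD0) ler_pdivrMr// mul1r.
  exact: le_trans sD_ge1.
set u := (_ ^+ 2) => u1; have u0 : 0 <= u by exact: sqr_ge0.
have t0 : 0 <= tau ^+ 2 by exact: sqr_ge0.
by rewrite mulr_ge0 ?subr_ge0//= ler_piMr// gerBl.
Qed.

(** Each slot vector is 8 times a point of the l_p ball. The part along [x q] has power sum at most
    1; the noise part has at most [tau ^ p * 2 * D ^ (1 - p / m) = 2], which is what determines
    [tau], using [2 r <= m] to pass from the power [2 r] to [m]. Then [(1 + 2) / 4 <= 1]. *)
Lemma mform_energy_le (T : tensor R r d) (z : 'I_r -> option 'I_d -> R) :
  (forall q, \sum_b `|z q b| ^+ (2 * r) <= 1) ->
  mform T (fun q i => z q None * x q i +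
      z q (Some i) * Num.sqrt (block_var (L := 'I_d) s (x q) i)) <=
  8 ^+ r * injective_norm p T.
Proof.
move=> hz.
pose y q i := (z q None * x q i +
      z q (Some i) * Num.sqrt (block_var (L := 'I_d) s (x q) i)) / 8.
set u := (X in mform T X).
have -> : u = fun q i => 8 * y q i.
  by apply/funext => q; apply/funext => i; rewrite /u /y; field.
rewrite mform_scale ler_wpM2l ?exprn_ge0//.
apply: mform_le_injective_norm => // q.
have z1 b : `|z q b| <= 1.
  have r2 : (0 < 2 * r)%N by rewrite muln_gt0.
  rewrite -(ler_pXn2r r2) ?nnegrE// expr1n.
  apply: le_trans (hz q); rewrite (bigD1 b) //= lerDl.
  by apply: sumr_ge0 => c _; apply: exprn_ge0.
have hzm : \sum_i `|z q (Some i)| `^ m <= 1.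
  apply: le_trans (hz q); rewrite (bigD1 None) //=.
  rewrite -[leLHS]add0r lerD ?exprn_ge0//.
  rewrite (reindex_omap Some id) /=; last by case.
  under [leRHS]eq_bigl => i do rewrite eqxx.
  apply: ler_sum => i _; rewrite -powR_mulrn//.
  have [->|zn0] := eqVneq `|z q (Some i)| 0.
    by rewrite !powR0// ?pnatr_eq0 ?muln_eq0 ?gt_eqF//= -lt0n.
  by apply: ger_powR => //; rewrite lt0r zn0 normr_ge0 z1.
have zp : \sum_i `|z q (Some i) * Num.sqrt (block_var (L := 'I_d) s (x q) i)| `^ p <= 2.
  apply: (@le_trans _ _ (\sum_i tau `^ p * `|z q (Some i)| `^ p)).
    apply: ler_sum => i _; rewrite normrM mulrC powRM// ler_wpM2r ?powR_ge0//.
    have /andP[v0 v1] := var_bounds q i.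
    rewrite ge0_ler_powR ?nnegrE ?(ltW p0) ?(ltW tau0)//.
    rewrite ger0_norm ?sqrtr_ge0// -[leRHS](ger0_norm (ltW tau0)) -sqrtr_sqr.
    exact: ler_wsqrtr.
  have := @sum_powR_le R 'I_d p m (fun i => z q (Some i)).
  rewrite card_ord -/D => /(_ d_gt0 (ltW p0) pm m0 hzm) h.
  rewrite -mulr_sumr; apply: le_trans (ler_wpM2l (powR_ge0 _ _) h) _.
  rewrite mulrCA -powRrM -powRD; last exact: Dimp.
  rewrite (_ : (_ + _) = 0) ?powRr0 ?mulr1//.
  by field; rewrite !gt_eqF.
apply: (@le_trans _ _ (\sum_i (`|z q None * x q i| `^ p +
    `|z q (Some i) * Num.sqrt (block_var (L := 'I_d) s (x q) i)| `^ p) / 4)).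
  by apply: ler_sum => i _; exact: powR_avg_le.
rewrite -mulr_suml big_split /=.
have : \sum_i `|z q None * x q i| `^ p <= 1.
  apply: le_trans (hx q); apply: ler_sum => i _.
  by rewrite ge0_ler_powR ?nnegrE ?(ltW p0)// normrM ler_piMl.
lra.
Qed.

(** On the l_p ball the squared l_2 norm is at most [2 * D ^ (1 - 2 / p)]; dividing by
    [tau ^ 2 = D ^ (2 / m - 2 / p)] gives the exponent. *)
Lemma sum_mean_shift_le :
  \sum_q \sum_a mean_shift (L := 'I_d) s (x q) a ^+ 2 <= 2 * r%:R * D `^ (1 - 2 / m).
Proof.
have sL : s * #|'I_d|%:R != 0.
  by rewrite card_ord gt_eqF// (lt_le_trans _ sD_ge1).
rewrite (_ : 2 * r%:R * _ = \sum_(q < r) 2 * D `^ (1 - 2 / m)); last first.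
  by rewrite sumr_const card_ord -[_ *+ _]mulr_natr; ring.
apply: ler_sum => q _; rewrite (sum_mean_shift _ _ sL) card_ord -/D s2D.
rewrite ler_pdivrMr ?exprn_gt0//.
have := @sum_powR_le R 'I_d 2 p (x q).
rewrite card_ord -/D => /(_ d_gt0 (ler0n _ _) p2 p0 (hx q)) h.
have -> : \sum_i x q i ^+ 2 = \sum_i `|x q i| `^ 2.
  by apply: eq_bigr => i _; rewrite powR_mulrn// real_normK ?num_real.
apply: le_trans h _; rewrite -mulrA ler_wpM2l//.
rewrite -powR_mulrn ?(ltW tau0)// -powRrM -powRD; last exact: Dimp.
rewrite (_ : 1 - 2 / m + _ = 1 - 2 / p)//.
by field; rewrite !gt_eqF.
Qed.

Lemma tilted_energy_le (T : tensor R r d) :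
  avg (fun e => prod_tilt (L := 'I_d) s x e * mform T (blocks s e) ^+ 2) <=
  (r%:R * 4 / 3) ^+ 2 * 3 ^+ r * (8 ^+ r * injective_norm p T) ^+ 2.
Proof.
apply: avg_prod_tilt_mform_sqr_le => //.
- by rewrite card_ord gt_eqF// (lt_le_trans _ sD_ge1).
- by rewrite mulr_ge0 ?exprn_ge0// injective_norm_ge0.
- by move=> q i; have /andP[] := var_bounds q i.
- exact: mform_energy_le.
Qed.

End Ball.

Let K1 : R := (r%:R * 4 / 3) ^+ 2 * 3 ^+ r * (8 ^+ r) ^+ 2.

(** Both terms come from [(a + Z) ^ 2 <= 2 a ^ 2 + 2 Z ^ 2], with [a] the energy plus entropy and
    [Z] the partition function. *)
Definition type2_factor : R := 2 * (4 * K1 + 2 * r%:R) ^+ 2 + 2.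

Lemma finite_type2 n (T : 'I_n -> tensor R r d) :
  avg (fun b : {ffun 'I_n -> bool} =>
    injective_norm p (\sum_k sg (b k) *: T k) ^+ 2) <=
  type2_factor * D `^ (1 - 2 / m) * \sum_k injective_norm p (T k) ^+ 2.
Proof.
set N := fun b : {ffun 'I_n -> bool} => injective_norm p (\sum_k (sg (b k) : R) *: T k).
have K10 : 0 <= K1 by rewrite /K1 !mulr_ge0 ?sqr_ge0 ?exprn_ge0.
have K2 : 0 < type2_factor by rewrite /type2_factor ltr_wpDl// mulr_ge0// sqr_ge0.
set Dm := D `^ (1 - 2 / m).
have Dm0 : 0 < Dm by exact: powR_gt0.
have Dm1 : 1 <= Dm.
  rewrite -[leLHS](powRr0 D) ler_powR// subr_ge0 ler_pdivrMr// mul1r.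
  exact: le_trans pm.
(* A positive majorant [S] of the sum of squared norms keeps [lam] well defined when all norms
   vanish; the sum itself is reached by letting [S] decrease to it. *)
suff main (S : R) : 0 < S -> \sum_k injective_norm p (T k) ^+ 2 <= S ->
    avg (fun b => N b ^+ 2) <= type2_factor * Dm * S.
  rewrite -ler_pdivrMl ?mulr_gt0//; apply/ler_addgt0Pr => e e0.
  rewrite ler_pdivrMl ?mulr_gt0//; apply: main; last by rewrite lerDl ltW.
  by rewrite ltr_wpDl// sumr_ge0// => k _; exact: sqr_ge0.
move=> S0 TS.
(* This balances the two costs: the energy [4 lam ^ 2 K1 S] becomes [4 K1 Dm], of the same order as
   the entropy [2 r Dm]. *)
pose lam := Num.sqrt (Dm / S).
have lam0 : 0 < lam by rewrite sqrtr_gt0 divr_gt0.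
have lam2 : lam ^+ 2 = Dm / S by rewrite sqr_sqrtr// ltW ?divr_gt0.
pose Z (b : {ffun 'I_n -> bool}) := partition_function 'I_d s lam T (fun k => sg (b k)).
pose a := (4 * K1 + 2 * r%:R) * Dm.
have a0 : 0 <= a by rewrite mulr_ge0 ?(ltW Dm0)// addr_ge0 ?mulr_ge0.
have Z0 b : 0 <= Z b by exact: partition_function_ge0.
have NZ b : lam * N b <= a + Z b.
  rewrite mulrC -ler_pdivlMr//; apply: injective_norm_le => // x hx.
  rewrite mform_sum ler_pdivlMr// mulrC.
  have sL : s * #|'I_d|%:R != 0.
    by rewrite card_ord gt_eqF// (lt_le_trans _ sD_ge1).
  apply: le_trans (pac_bayes 'I_d s lam T x (fun k => sg (b k)) sL _) _.
    move=> q i; rewrite card_ord -/D; apply: le_trans (ball_coord_le1 p p1 _ (hx q) i) _.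
    exact: le_trans sD_ge1 (ler_norm _).
  rewrite -/(Z b) lerD2r /a [leRHS]mulrDl; apply: lerD; last exact: sum_mean_shift_le.
  have E : \sum_k avg (fun e => prod_tilt (L := 'I_d) s x e * mform (T k) (blocks s e) ^+ 2) <= K1 * S.
    apply: le_trans (ler_wpM2l K10 TS); rewrite mulr_sumr; apply: ler_sum => k _.
    apply: le_trans (tilted_energy_le _ hx _) _.
    by rewrite [(_ * injective_norm _ _) ^+ 2]exprMn mulrA.
  apply: le_trans (ler_wpM2l _ E) _; first by rewrite mulr_ge0// sqr_ge0.
  rewrite lam2 le_eqVlt; apply/orP; left; apply/eqP.
  by field; rewrite gt_eqF.
have sqNZ b : lam ^+ 2 * N b ^+ 2 <= 2 * a ^+ 2 + 2 * Z b ^+ 2.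
  rewrite -exprMn; apply: (@le_trans _ _ ((a + Z b) ^+ 2)).
    have N0 : 0 <= N b by exact: injective_norm_ge0.
    by rewrite lerXn2r ?nnegrE ?(mulr_ge0 (ltW lam0))// addr_ge0.
  have := sqr_ge0 (a - Z b); nra.
have C : (0 < #|{: {ffun 'I_n -> bool}}|)%N by rewrite card_ffun_gt0 ?card_bool.
have : lam ^+ 2 * avg (fun b => N b ^+ 2) <= 2 * a ^+ 2 + 2.
  rewrite -avgZ; apply: le_trans (le_avg _ _ _ sqNZ) _.
  rewrite avgD avg_cst// avgZ lerD2l.
  have := avg_partition_function_sqr 'I_d s lam T; rewrite -/Z; lra.
rewrite lam2 mulrAC ler_pdivrMr// -ler_pdivlMl// => H; apply: le_trans H _.
rewrite ler_pdivrMl//.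
rewrite (_ : Dm * _ = type2_factor * Dm ^+ 2 * S); last by ring.
rewrite ler_wpM2r ?(ltW S0)//.
have Dm2 : 1 <= Dm ^+ 2 by rewrite exprn_ege1.
rewrite /type2_factor /a exprMn; nra.
Qed.

End FiniteType2.

(** * Independent Rademacher variables *)

Lemma one_neqN1 (R : realType) : (1 : R) <> -1.
Proof. by move=> h; lra. Qed.

Section RademacherExpectation.
Import HBNNSimple.
Local Open Scope classical_set_scope.
Local Open Scope ring_scope.
Context {R : realType} {dO : measure_display} {Omega : measurableType dO}.
Variables (P : probability Omega R) (n : nat) (e : 'I_n -> {RV P >-> R}).
Hypothesis he : iid_rademacher e.

Let cyl (b : {ffun 'I_n -> bool}) : set Omega :=
  \bigcap_(k in [set` [set: 'I_n]%SET]) (e k @^-1` [set sg (b k)]).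

Let measurable_cyl b : measurable (cyl b).
Proof.
apply: fin_bigcap_measurable; first exact: finite_finset.
by move=> k _; rewrite -[X in measurable X]setTI; exact: measurable_funP.
Qed.

Let prob_cyl b : P (cyl b) = (#|{ffun 'I_n -> bool}|%:R^-1)%:E.
Proof.
rewrite (he.1 [set: 'I_n]%SET (fun k => [set sg (b k)])) //.
rewrite (eq_bigr (fun=> (2^-1)%:E)); last first.
  move=> k _; have [h1 hN1] := he.2 k.
  by case: (b k); [rewrite -hN1 /sg expr1|rewrite -h1 /sg expr0].
by rewrite prodEFin prodr_const cardsT card_ffun card_bool card_ord natrX exprVn.
Qed.

(** The two prescribed masses add up to 1, so the remaining values form a null set. *)
Let ae_signs : \forall w \ae P, forall k, e k w = 1 \/ e k w = -1.
Proof.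
apply: filter_forall => k.
pose A := e k @^-1` [set 1]; pose B := e k @^-1` [set -1].
have mA : measurable A by rewrite -[X in measurable X]setTI; exact: measurable_funP.
have mB : measurable B by rewrite -[X in measurable X]setTI; exact: measurable_funP.
exists (~` (A `|` B)); split.
- by apply: measurableC; exact: measurableU.
- rewrite probability_setC; last exact: measurableU.
  rewrite measureU//; last first.
    by apply/seteqP; split => w //= -[]; rewrite /A /B /= => -> /one_neqN1.
  have [h1 hN1] := he.2 k.
  rewrite [X in (_ - (X + _))%E](_ : _ = (2^-1)%:E)//.
  rewrite [X in (_ - (_ + X))%E](_ : _ = (2^-1)%:E)//.
  have halves : 2^-1 + 2^-1 = 1 :> R by lra.
  rewrite -EFinD halves; exact: (@subee R 1%E).
- by move=> w /= nh [h|h]; apply: nh; [left|right].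
Qed.

(* [G] need not be measurable, so its integral is the supremum of the integrals of the
   simple functions below it. *)
Lemma expectation_signs_le (G : Omega -> R) (v : {ffun 'I_n -> bool} -> R) :
  (forall w, 0 <= G w) -> (forall b, 0 <= v b) ->
  (forall w (b : {ffun 'I_n -> bool}), (forall k, e k w = sg (b k)) -> G w = v b) ->
  ('E_P[G] <= (avg v)%:E)%E.
Proof.
move=> G0 v0 Gv; rewrite unlock ge0_integralTE; last by move=> w; rewrite lee_fin.
apply: ge_ereal_sup => _ [h /= hG <-]; rewrite -integralT_nnsfun.
(* The sum of the [g b] is a measurable step function with integral [avg v], and it dominates [h]
   wherever all variables take values [1] or [-1]. *)
pose g b w : \bar R := ((v b)%:E * (\1_(cyl b) w)%:E)%E.
have g0 b w : (0 <= g b w)%E by rewrite /g -EFinM lee_fin mulr_ge0.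
have mg b : measurable_fun setT (g b).
  rewrite (_ : g b = EFin \o (fun w => v b * \1_(cyl b) w))//.
  by apply/measurable_EFinP; apply: measurable_funM => //; exact: measurable_indic.
have -> : (avg v)%:E = (\int[P]_w (\sum_b g b w))%E.
  rewrite ge0_integral_sum// /avg mulr_suml -sumEFin; apply: eq_bigr => b _.
  rewrite ge0_integralZl_EFin//; last by apply/measurable_EFinP; exact: measurable_indic.
  by rewrite integral_indic// setIT EFinM -(prob_cyl b).
apply: ae_ge0_le_integral => //.
- by move=> w _; rewrite lee_fin; exact: fun_ge0.
- by apply/measurable_EFinP; exact: measurable_funP.
- by move=> w _; apply: sume_ge0.
- exact: emeasurable_sum.
apply: filterS ae_signs => w hw _.
pose b : {ffun 'I_n -> bool} := [ffun k => e k w != 1].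
have eb k : e k w = sg (b k).
  rewrite /b ffunE; have [->|ne1] := eqVneq (e k w) 1; first by rewrite /sg expr0.
  by rewrite /sg expr1; case: (hw k) ne1 => // ->; rewrite eqxx.
apply: le_trans (hG w) _; rewrite (Gv w b eb).
rewrite (bigD1 b) //= {1}/g indicE mem_set ?mule1; last by move=> k _; exact: eb.
by rewrite leeDl// sume_ge0.
Qed.

End RademacherExpectation.

(** * A concrete probability space of fair signs *)

Section SignSpace.
Local Open Scope classical_set_scope.
Local Open Scope ring_scope.
Context {R : realType} (n : nat).

(** The lower bound has to apply [type2_bound] to an actual Rademacher family. This copy of the sign
    patterns carries the discrete sigma-algebra, for which every function is measurable. *)
Definition sign_space : Type := {ffun 'I_n -> bool}.

HB.instance Definition _ := Finite.on sign_space.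

HB.instance Definition _ := isPointed.Build sign_space [ffun=> true].

HB.instance Definition _ := @isMeasurable.Build default_measure_display
  sign_space discrete_measurable discrete_measurable0
  discrete_measurableC discrete_measurableU.

Local Notation W := sign_space.
Let w0 : W := [ffun=> true].

Let card_inv_ge0 : 0 <= #|{: W}|%:R^-1 :> R.
Proof. by rewrite invr_ge0. Qed.

(** The uniform law, written as a scaled sum of Dirac masses so that its measure structure is
    inherited. *)
Definition sign_measure : set W -> \bar R :=
  mscale (NngNum card_inv_ge0) (msum (fun i => @dirac _ W (nth w0 (enum {: W}) i) R) #|{: W}|).

HB.instance Definition _ := Measure.on sign_measure.

Lemma sign_measureE (A : set W) : sign_measure A = (avg (fun w => \1_A w : R))%:E.
Proof.
rewrite /sign_measure /mscale /= /msum /avg mulrC EFinM; congr (_ * _)%E.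
rewrite -sumEFin /dirac -(big_mkord predT (fun i => (\1_A (nth w0 (enum {: W}) i))%:E : \bar R)).
by rewrite cardE -(big_nth w0 predT (fun w => (\1_A w)%:E : \bar R)) big_enum.
Qed.

Lemma sign_measureT : sign_measure setT = 1%E.
Proof.
rewrite sign_measureE (eq_avg _ _ (fun=> 1)); last by move=> w; rewrite indicT.
by rewrite avg_cst ?card_ffun_gt0 ?card_bool.
Qed.

HB.instance Definition _ := Measure_isProbability.Build _ _ _ sign_measure sign_measureT.

Definition sign_coord (k : 'I_n) (w : W) : R := sg (w k).

Lemma measurable_sign_coord k : measurable_fun setT (sign_coord k).
Proof. by []. Qed.

HB.instance Definition _ k := isMeasurableFun.Build _ _ _ _ (sign_coord k) (measurable_sign_coord k).

Definition sign_probability : probability W R := sign_measure.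

Definition sign_rv (k : 'I_n) : {RV sign_probability >-> R} := sign_coord k.

Lemma avg_coord (k : 'I_n) (g : bool -> R) : avg (fun w : W => g (w k)) = avg g.
Proof.
transitivity (avg (fun w : W => \prod_k' (if k' == k then g (w k') else 1))).
  by apply: eq_avg => w; rewrite (bigD1 k) //= eqxx big1 ?mulr1// => k' /negPf ->.
rewrite (avg_prod _ _ (fun k' b => if k' == k then g b else 1)) (bigD1 k) //= eqxx.
by rewrite big1 ?mulr1// => k' /negPf ->; rewrite avg_cst// card_bool.
Qed.

(** The indicator of the joint event is a product of functions of single coordinates, so [avg_prod]
    factors its average. *)
Lemma sign_rv_iid : iid_rademacher sign_rv.
Proof.
split.
  move=> J A _; rewrite /= !sign_measureE.
  rewrite (eq_bigr (fun k => (avg (fun b => \1_(A k) (sg b) : R))%:E)); last first.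
    by move=> k _; rewrite sign_measureE -(avg_coord k).
  rewrite prodEFin; congr EFin.
  transitivity (avg (fun w : W => \prod_k (if k \in J then \1_(A k) (sg (w k)) : R else 1))).
    apply: eq_avg => w; rewrite -big_mkcond /=.
    have [h|h] := pselect (forall k, k \in J -> A k (sg (w k))).
      rewrite indicE mem_set; last by move=> k; exact: h.
      by rewrite big1// => k kJ; rewrite indicE mem_set//; exact: h.
    move/existsNP : (h) => [k /not_implyP[kJ hk]].
    rewrite indicE memNset; last by move=> H; apply: hk; exact: (H k kJ).
    by rewrite (bigD1 k) //= indicE memNset// mul0r.
  rewrite (avg_prod _ _ (fun k b => if k \in J then \1_(A k) (sg b) : R else 1)).
  rewrite [RHS]big_mkcond; apply: eq_bigr => k _.
  by case: ifP => // _; rewrite avg_cst// card_bool.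
move=> k; split; rewrite /= sign_measureE; congr EFin.
  rewrite (avg_coord k (fun b => \1_[set 1] (sg b))) avg_bool /sg expr1 expr0 !indicE.
  rewrite memNset ?mem_set//=; first lra.
  by move/esym/one_neqN1.
rewrite (avg_coord k (fun b => \1_[set -1] (sg b))) avg_bool /sg expr1 expr0 !indicE.
rewrite mem_set// memNset//=; first lra.
by move/one_neqN1.
Qed.

End SignSpace.

(** * The lower bound *)

Section LowerBound.
Context {R : realType} {r d : nat}.
Variables (p : R) (q0 : 'I_r) (i0 : 'I_d).
Hypothesis p1 : 1 <= p.

Let r_gt0 : (0 < r)%N. Proof. exact: leq_ltn_trans (ltn_ord q0). Qed.
Let d_gt0 : (0 < d)%N. Proof. exact: leq_ltn_trans (ltn_ord i0). Qed.
Let D : R := d%:R.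
Let D0 : 0 < D. Proof. by rewrite ltr0n. Qed.
Let p0 : 0 < p. Proof. exact: lt_le_trans p1. Qed.

Let idx (k : 'I_d) : {ffun 'I_r -> 'I_d} := [ffun q => if q == q0 then k else i0].

Let unit_tensor (k : 'I_d) : tensor R r d := [ffun j => (j == idx k)%:R].

Let mform_unit k z : mform (unit_tensor k) z = \prod_q z q (idx k q).
Proof.
rewrite /mform (bigD1 (idx k)) //= ffunE eqxx mul1r [X in _ + X]big1 ?addr0// => j /negPf jk.
by rewrite ffunE jk mul0r.
Qed.

Lemma injective_norm_unit_le1 k : injective_norm p (unit_tensor k) <= 1.
Proof.
apply: injective_norm_le => // z hz; rewrite mform_unit.
apply: le_trans (ler_norm _) _; rewrite normr_prod; apply: prodr_ile1 => q _.
by rewrite normr_ge0 /=; exact: (ball_coord_le1 p p1 _ (hz q)).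
Qed.

Lemma injective_norm_sum_unit_ge (b : {ffun 'I_d -> bool}) :
  D `^ (1 - p^-1) <= injective_norm p (\sum_k (sg (b k) : R) *: unit_tensor k).
Proof.
(* In slot [q0] the sign vector itself, scaled to unit l_p norm; elsewhere the basis vector [i0].
   Each of the [d] terms then contributes [D ^ (- 1 / p)]. *)
pose z q i : R := if q == q0 then sg (b i) * D `^ (- p^-1) else (i == i0)%:R.
apply: le_trans (mform_le_injective_norm p p1 _ z _); last first.
  move=> q; rewrite /z; case: eqP => _.
    rewrite (eq_bigr (fun=> D^-1)); last first.
      move=> i _; rewrite normrM /sg normr_sign mul1r ger0_norm ?powR_ge0//.
      by rewrite -powRrM mulNr mulVf ?gt_eqF// powR_inv1// ltW.
    by rewrite sumr_const card_ord -[_ *+ _]mulr_natr mulVf// gt_eqF.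
  rewrite (bigD1 i0) //= eqxx normr1 one_powR big1 ?addr0// => i /negPf ->.
  by rewrite normr0 powR0// gt_eqF.
rewrite mform_sum (eq_bigr (fun=> D `^ (- p^-1))); last first.
  move=> k _; rewrite mform_unit (bigD1 q0) //= big1 => [|q /negPf qn].
    by rewrite /z /idx ffunE eqxx mulr1 mulrA -expr2 sqr_sg mul1r.
  by rewrite /z /idx ffunE qn eqxx.
rewrite sumr_const card_ord -[_ *+ _]mulr_natl -/D powRD ?powRr1 ?(ltW D0)//.
by rewrite (gt_eqF D0) implybT.
Qed.

(** On the sign space the left side of the type-2 inequality is at least [D ^ (2 - 2 / p)], while
    the right side is at most [C ^ 2 * D]. *)
Lemma type2_bound_ge C : 0 <= C -> type2_bound r p d C -> D `^ (2^-1 - p^-1) <= C.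
Proof.
move=> C0 /(_ d unit_tensor d_gt0 _ _ (sign_probability (R := R) d)
  (sign_rv (R := R) d) (sign_rv_iid d)) hC.
rewrite -(@ler_pXn2r _ 2) ?nnegrE ?powR_ge0//.
rewrite -(ler_pM2r D0).
have -> : (D `^ (2^-1 - p^-1)) ^+ 2 * D = (D `^ (1 - p^-1)) ^+ 2.
  have imp c : c ==> (D != 0) by rewrite (gt_eqF D0) implybT.
  rewrite -[X in _ * X](powRr1 (ltW D0)) -!powR_mulrn ?powR_ge0// -!powRrM -powRD//.
  by congr (_ `^ _); field; rewrite gt_eqF.
rewrite -lee_fin; apply: (@le_trans _ _ (C ^+ 2 * \sum_k injective_norm p (unit_tensor k) ^+ 2)%:E); last first.
  rewrite lee_fin ler_wpM2l ?sqr_ge0//.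
  apply: (@le_trans _ _ (\sum_(k < d) 1)); last by rewrite sumr_const card_ord.
  apply: ler_sum => k _; rewrite expr_le1 ?injective_norm_unit_le1//.
  exact: injective_norm_ge0.
apply: le_trans hC; rewrite unlock.
rewrite [leLHS](_ : _ = \int[sign_probability (R := R) d]_w ((D `^ (1 - p^-1)) ^+ 2)%:E)%E; last first.
  by rewrite integral_cst// [X in (_ * X)%E](sign_measureT d) mule1.
apply: ge0_le_integral => //.
- by move=> w _; rewrite lee_fin sqr_ge0.
- move=> w _; rewrite lee_fin lerXn2r ?nnegrE ?powR_ge0 ?injective_norm_ge0//.
  exact: injective_norm_sum_unit_ge.
Qed.

End LowerBound.

(** * Both bounds for the type-2 constant *)

Theorem theorem1p2 (R : realType) (r : nat) (p : R) (hr : (2 <= r)%N) (hp : 2 <= p) :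
  exists c C : R, 0 < c /\ 0 < C /\
    forall d : nat, (2 <= d)%N ->
      ((c * d%:R `^ (2^-1 - p^-1))%:E <= type2_constant r p d)%E /\
      (type2_constant r p d <=
        (C * d%:R `^ (2^-1 - (Num.max p (2 * r)%:R)^-1) * ln d%:R)%:E)%E.
Proof.
have r0 : (0 < r)%N by apply: leq_trans hr.
have p1 : 1 <= p by apply: le_trans hp; rewrite ler1n.
pose K : R := type2_factor (R := R) (r := r).
have K0 : 0 < K by rewrite /K /type2_factor ltr_wpDl// mulr_ge0// sqr_ge0.
have l2 : 0 < ln 2 :> R by rewrite ln_gt0// ltr1n.
(* The upper estimate holds without a logarithm; since [d >= 2], the factor [ln d / ln 2] is at
   least 1 and can be inserted. *)
exists 1, (Num.sqrt K / ln 2); split; first exact: ltr01.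
split; first by rewrite divr_gt0// sqrtr_gt0.
move=> d d2; have d0 : (0 < d)%N by apply: leq_trans d2.
split.
  apply: le_ereal_inf_tmp => _ [C [C0 hC] <-]; rewrite lee_fin mul1r.
  exact: (type2_bound_ge p (Ordinal r0) (Ordinal d0) p1).
apply: ereal_inf_lbound; set B := (X in X%:E); exists B => //.
have ld : ln 2 <= ln d%:R :> R by rewrite ler_ln ?posrE ?ltr0n// ler_nat.
have ld0 : 0 < ln d%:R :> R by exact: lt_le_trans ld.
split; first by rewrite /B !mulr_ge0 ?invr_ge0 ?sqrtr_ge0 ?powR_ge0 ?ltW.
move=> n T n0 dO Omega P e he.
apply: le_trans (expectation_signs_le P n e he _
  (fun b => injective_norm p (\sum_k sg (b k) *: T k) ^+ 2) _ _ _) _.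
- by move=> w; exact: sqr_ge0.
- by move=> b; exact: sqr_ge0.
- by move=> w b eb; under eq_bigr => k _ do rewrite eb.
rewrite lee_fin; apply: le_trans (finite_type2 p hp r0 d0 n T) _.
rewrite ler_wpM2r//; first by apply: sumr_ge0 => k _; exact: sqr_ge0.
set m := Num.max _ _.
have -> : d%:R `^ (1 - 2 / m) = (d%:R `^ (2^-1 - m^-1)) ^+ 2 :> R.
  by rewrite -powR_mulrn ?powR_ge0// -powRrM; congr (_ `^ _); rewrite mulrBl mulVf// mulrC.
rewrite (_ : B ^+ 2 = Num.sqrt K ^+ 2 * (d%:R `^ (2^-1 - m^-1)) ^+ 2 * (ln d%:R / ln 2) ^+ 2).
  rewrite sqr_sqrtr ?(ltW K0)// ler_peMr ?mulr_ge0 ?sqr_ge0 ?(ltW K0)//.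
  by rewrite exprn_ege1// ler_pdivlMr// mul1r.
by rewrite /B -/m; field; rewrite gt_eqF.
Qed.
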